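(* Let $A,B,C$ be pairwise disjoint finite subsets of $\mathbb Z$ and let $\varphi$ be a faithful state on $\mathcal A_{ABC}=\mathcal A(A\cup B\cup C)$ with density $\rho$. Then $\varphi$ satisfies equality in strong subadditivity, i.e. $S(\varphi)-S(\varphi_{AB})-S(\varphi_{BC})+S(\varphi_B)=0$, if and only if there are positive elements $x\in\mathcal A_{AB}$ and $y\in\mathcal A_{BC}$ such that $$\rho=xy.$$
   Context: CAR algebra: the $C^*$-algebra generated by $\{a_i: i\in\mathbb Z\}$ with $a_ia_j+a_ja_i=0$ and $a_ia_j^*+a_j^*a_i=\delta_{ij}1$ for all $i,j$. For $I\subset\mathbb Z$, $\mathcal A(I)$ is the unital $C^*$-subalgebra generated by $\{a_i: i\in I\}$; for finite $I$ it is isomorphic to the full matrix algebra $M_{2^{|I|}}(\mathbb C)$. $\tau$ is the unique tracial state. For disjoint finite $A,B,C$ write $\mathcal A_{AB}=\mathcal A(A\cup B)$, $\mathcal A_{BC}=\mathcal A(B\cup C)$, $\mathcal A_B=\mathcal A(B)$, and let $\varphi_{AB},\varphi_{BC},\varphi_B$ be the restrictions of $\varphi$ to these algebras. The density of a state $\psi$ on $\mathcal A(I)$ ($I$ finite) is the element $\rho_\psi\in\mathcal A(I)$ with $\psi(x)=\tau(\rho_\psi x)$ for all $x\in\mathcal A(I)$, and the entropy is $S(\psi)=-\tau(\rho_\psi\log\rho_\psi)$. The inequality $S(\varphi)-S(\varphi_{AB})-S(\varphi_{BC})+S(\varphi_B)\le 0$ always holds. *)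

(* Defs.v *)
(* MathComp / MathComp-Analysis *)
From HB Require Import structures.
From mathcomp Require Import all_boot all_order all_algebra.
From mathcomp Require Import all_classical all_reals all_analysis.
From mathcomp Require Export complex.

Set Implicit Arguments.
Unset Strict Implicit.
Unset Printing Implicit Defensive.

Import Order.TTheory GRing.Theory Num.Theory.
Import numFieldNormedType.Exports.

Local Open Scope classical_set_scope.
Local Open Scope ring_scope.

(* Unital C*-algebras; [algType] makes them associative, unital and nonzero.
   [c^*] is conjugation of scalars, [star] is the involution of the algebra.
   The norm is a field of the mixin, since a join of the ring and normed-module
   structures of the library would conflict with that of [numDomainType]. *)
HB.mixin Record isCStarAlgebra (R : realType) (T : Type)
    of GRing.Algebra R[i] T := {
  star : T -> T;
  starK : forall x : T, star (star x) = x;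
  starD : forall x y : T, star (x + y) = star x + star y;
  starZ : forall (c : R[i]) (x : T), star (c *: x) = c^* *: star x;
  starM : forall x y : T, star (x * y) = star y * star x;
  cnorm : T -> R;
  cnorm_eq0 : forall x : T, cnorm x = 0 -> x = 0;
  cnormD : forall x y : T, cnorm (x + y) <= cnorm x + cnorm y;
  cnormZ : forall (c : R[i]) (x : T), (cnorm (c *: x))%:C%C = `|c| * (cnorm x)%:C%C;
  cnormM : forall x y : T, cnorm (x * y) <= cnorm x * cnorm y;
  cnorm_star : forall x : T, cnorm (star x * x) = cnorm x ^+ 2;
  cnorm_complete : forall u : nat -> T,
    (forall e : R, 0 < e -> exists N, forall m n,
       (N <= m)%N -> (N <= n)%N -> cnorm (u m - u n) < e) ->
    exists x : T, (fun n => cnorm (u n - x)) @ \oo --> (0 : R)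
}.

#[short(type="cstarAlgType")]
HB.structure Definition CStarAlgebra (R : realType) :=
  { T of GRing.Algebra R[i] T & isCStarAlgebra R T }.

Section CStar.
Variables (R : realType) (T : cstarAlgType R).
Implicit Types (D E : set T) (phi tau : T -> R[i]).

Definition norm_closed D : Prop :=
  forall (u : nat -> T) (x : T), (forall n, D (u n)) ->
    (fun n => cnorm (u n - x)) @ \oo --> (0 : R) -> D x.

Definition cstar_subalgebra D : Prop :=
  [/\ D 1,
      forall (c : R[i]) x y, D x -> D y -> D (c *: x + y),
      forall x y, D x -> D y -> D (x * y),
      forall x, D x -> D (star x) &
      norm_closed D].

Definition cstar_generated E : set T :=
  [set x | forall D, cstar_subalgebra D -> E `<=` D -> D x].

Definition positive_in D (x : T) : Prop :=
  exists2 z, D z & x = star z * z.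

(* A functional on a subalgebra [D] is a function on [T] of which only the
   values on [D] matter, so a functional and its restriction to a smaller
   subalgebra are represented by the same function. *)
Definition state_on D phi : Prop :=
  [/\ forall (c : R[i]) x y, D x -> D y -> phi (c *: x + y) = c * phi x + phi y,
      forall x, D x -> 0 <= phi (star x * x) &
      phi 1 = 1].

Definition faithful_on D phi : Prop :=
  forall x, D x -> phi (star x * x) = 0 -> x = 0.

Definition tracial_state tau : Prop :=
  state_on [set: T] tau /\ forall x y, tau (x * y) = tau (y * x).

Definition is_density tau D phi (rho : T) : Prop :=
  D rho /\ forall x, D x -> phi x = tau (rho * x).

Definition density tau D phi : T := xget 0 [set rho | is_density tau D phi rho].

(* [x] = \sum_k l_k p_k with mutually orthogonal projections p_k of sum 1.
   The l_k need not be distinct. *)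
Definition spectral_resolution (x : T) n (l : 'I_n -> R) (p : 'I_n -> T) : Prop :=
  [/\ forall k, star (p k) = p k,
      forall j k, p j * p k = if j == k then p k else 0,
      \sum_k p k = 1 &
      x = \sum_k (l k)%:C%C *: p k].

(* Functional calculus for self-adjoint elements of finite spectrum, which
   include all self-adjoint elements of finite-dimensional subalgebras. *)
Definition funcalc (f : R -> R) (x : T) : T :=
  xget 0 [set y | exists n (l : 'I_n -> R) (p : 'I_n -> T),
    spectral_resolution x l p /\ y = \sum_k (f (l k))%:C%C *: p k].

(* [ln 0 = 0], whence the convention 0 log 0 = 0. *)
Definition entropy tau D phi : R[i] :=
  let rho := density tau D phi in - tau (rho * funcalc (@ln R) rho).

Definition car_generators (a : int -> T) : Prop :=
  [/\ forall i j, a i * a j + a j * a i = 0,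
      forall i j, a i * star (a j) + star (a j) * a i = (i == j)%:R &
      cstar_generated (range a) = [set: T]].

Definition car_local (a : int -> T) (I : set int) : set T :=
  cstar_generated (a @` I).

End CStar.

(* Main.v *)
From HB Require Import structures.
Require Import Defs.
From mathcomp Require Import all_boot all_order all_algebra.
From mathcomp Require Import all_classical all_reals all_analysis.
From mathcomp Require Import ring lra.

Set Implicit Arguments.
Unset Strict Implicit.
Unset Printing Implicit Defensive.

Import Order.TTheory GRing.Theory Num.Theory.
Import numFieldNormedType.Exports.

Local Open Scope classical_set_scope.
Local Open Scope ring_scope.

                                                                                 
                                                                       
                                                                            

                                                                                    
                                                                                   
                                                                                    
                                                                                     
                                                                                   
                                                                                 
                                                                                 
                                                                            
                                                                              
                                                                                     
                                                                          
                                                                                      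
                                                                           
                                                          

                                                                     

(** Write [sigma], [r], [b] for the densities of the restrictions of [phi] to AB, BC and B. All of
    them live in finite-dimensional star subalgebras on which [tau] is faithful, so spectral theory
    there needs only linear algebra and the inner product [tau (star x * y)].

    Odd elements over A and C anticommute, so there is no tensor factorization to rely on. Its
    substitute is a commuting square: splitting every mode into two self-adjoint anticommuting
    unitaries makes the local algebras Clifford algebras, and under [tau] an element of AB paired
    with an element of BC may be replaced by an element of B ([cliff_expectation]). In particular
    the functional with density [sigma] restricts to BC with density [b] ([marginal_square]).

    If [rho = x * y], then [x] and [y] commute because [rho] is self-adjoint, and both are
    invertible because [rho] is. With [x0], [y0] the parts of [x], [y] in B, the square gives
    [sigma = x * y0], [r = x0 * y] and [b = x0 * y0], all products of commuting factors. Logarithms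
    turn these into sums, and ln rho - ln sigma - ln r + ln b = 0 ([product_density_logs]); pairing
    with [rho] is equality of entropies.

    Conversely, equality of entropies says that the relative entropy of [rho] with respect to
    [sigma] does not decrease on restriction to BC. The decrease is an integral over s > 0 of
    nonnegative quadratic expressions in the difference of two resolvents of relative modular
    operators, so the resolvents agree, and with them all functions of the modular operators. The
    integer powers give sigma^n rho^-n = b^n r^-n for every integer n ([sufficiency]), a Connes
    cocycle identity at integer times.

    These identities yield rho = r w with w = b^-1 sigma in AB, where [w] commutes with every b^n
    r^-n. The factors [r] and [w] need not be positive; an invertible h in B is inserted to correct
    this: rho = (r b^-1 h)(h^-1 sigma). It is the density, in the algebra [N] of those elements of
    BC whose conjugates by powers of [b] commute with [w], of the functional given by [b]. The
    modular relation in [N] makes b^-1 h commute with [r], membership in [N] makes [h] commute with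
    [w], and invariance under the sign changes of the generators over C puts [h] into B
    ([factorization]). *)

(** * Star subalgebras, positive functionals and the spectral theorem *)

Section StarAlgebra.
Variables (R : realType) (T : cstarAlgType R).
Implicit Types (D E : set T) (x y z : T) (c : R[i]).

Lemma conj_rc (r : R) : (r%:C%C)^* = r%:C%C.
Proof. by apply: conj_Creal; rewrite complex_real. Qed.

Lemma conj_eq_rc (c : R[i]) : c^* = c -> c = (complex.Re c)%:C%C.
Proof. by move=> /CrealP/RRe_real ->. Qed.

Lemma starB : zmod_morphism (@star R T).
Proof.
by move=> x y; rewrite -scaleN1r starD starZ rmorphN rmorph1 scaleN1r.
Qed.

HB.instance Definition _ := GRing.isZmodMorphism.Build T T (@star R T) starB.

Lemma star1 : star 1 = 1 :> T.
Proof. by have := starM (star 1) (1 : T); rewrite mulr1 !starK mulr1. Qed.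

Lemma starZr (r : R) x : star (r%:C%C *: x) = r%:C%C *: star x.
Proof. by rewrite starZ conj_rc. Qed.

(** Norm closedness is left out, so that auxiliary subalgebras such as [N] in the factorization can
    be formed by algebra alone. *)
Definition star_subalgebra D : Prop :=
  [/\ D 1,
      forall c x y, D x -> D y -> D (c *: x + y),
      forall x y, D x -> D y -> D (x * y) &
      forall x, D x -> D (star x)].

Section Closure.
Variables (D : set T) (hD : star_subalgebra D).

Lemma salg1 : D 1. Proof. by case: hD. Qed.
Lemma salgM x y : D x -> D y -> D (x * y). Proof. by case: hD => _ _ h _; apply: h. Qed.
Lemma salg_star x : D x -> D (star x). Proof. by case: hD => _ _ _; apply. Qed.
Lemma salgP c x y : D x -> D y -> D (c *: x + y). Proof. by case: hD => _ h _ _; apply: h. Qed.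
Lemma salg0 : D 0.
Proof. by have := salgP (-1) salg1 salg1; rewrite scaleN1r addNr. Qed.
Lemma salgD x y : D x -> D y -> D (x + y).
Proof. by move=> dx dy; have := salgP 1 dx dy; rewrite scale1r. Qed.
Lemma salgZ c x : D x -> D (c *: x).
Proof. by move=> dx; have := salgP c dx salg0; rewrite addr0. Qed.
Lemma salgN x : D x -> D (- x).
Proof. by move=> dx; rewrite -scaleN1r; apply: salgZ. Qed.
Lemma salgB x y : D x -> D y -> D (x - y).
Proof. by move=> dx dy; apply: salgD => //; apply: salgN. Qed.
Lemma salg_sum (I : Type) (s : seq I) (P : pred I) (F : I -> T) :
  (forall i, P i -> D (F i)) -> D (\sum_(i <- s | P i) F i).
Proof. by move=> h; elim/big_ind: _ => //; [exact: salg0|exact: salgD]. Qed.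

Lemma salg_horner x (A : {poly R[i]}) : D x -> D (horner_alg x A).
Proof.
move=> dx; elim/poly_ind: A => [|A c dA]; first by rewrite rmorph0; exact: salg0.
rewrite rmorphD rmorphM /= horner_algX horner_algC.
by apply: salgD; [exact: salgM|apply: salgZ; exact: salg1].
Qed.

End Closure.

Definition findim D : Prop :=
  exists n (v : 'I_n -> T), forall x, D x -> exists k : 'I_n -> R[i], x = \sum_i k i *: v i.

Lemma lin_dep n (v : 'I_n -> T) (w : 'I_n.+1 -> T) :
  (forall i, exists k : 'I_n -> R[i], w i = \sum_j k j *: v j) ->
  exists2 k : 'I_n.+1 -> R[i], (exists i, k i != 0) & \sum_i k i *: w i = 0.
Proof.
move=> /choice[K hK].
pose M : 'M[R[i]]_(n.+1, n) := \matrix_(i, j) K i j.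
have : kermx M != 0.
  rewrite kermx_eq0 /row_free neq_ltn; apply/orP; left.
  by rewrite ltnS rank_leq_col.
move=> /rowV0Pn[u /sub_kermxP uM u0]; exists (u 0).
  apply/existsP; apply: contraNT u0 => /existsPn h.
  by apply/eqP/rowP => i; rewrite mxE; apply/eqP; have := h i; rewrite negbK.
under eq_bigr do rewrite hK scaler_sumr.
rewrite exchange_big /= big1 // => j _.
have := congr1 (fun A : 'rV_n => A 0 j) uM; rewrite !mxE => e.
under eq_bigr do rewrite scalerA.
rewrite -scaler_suml [X in X *: _](_ : _ = 0) ?scale0r // -[RHS]e.
by apply: eq_bigr => i _; rewrite mxE.
Qed.

Lemma horner_algZ x c (A : {poly R[i]}) :
  horner_alg x (c *: A) = c *: horner_alg x A.
Proof. by rewrite -mul_polyC rmorphM /= horner_algC mulr_algl. Qed.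

Lemma star_horner x (A : {poly R[i]}) : star x = x ->
  star (horner_alg x A) = horner_alg x (map_poly Num.conj A).
Proof.
move=> xs; elim/poly_ind: A => [|A c IH]; first by rewrite !rmorph0 raddf0.
rewrite !rmorphD !rmorphM /= map_polyX map_polyC /= horner_algX !horner_algC.
rewrite raddfD /= starM xs IH starZ star1; congr (_ + _).
by rewrite -{1}(horner_algX x) -rmorphM mulrC rmorphM /= horner_algX.
Qed.

Lemma annihilating_poly D x : star_subalgebra D -> findim D -> D x ->
  exists2 A : {poly R[i]}, A != 0 & horner_alg x A = 0.
Proof.
move=> hD [n [v hv]] dx.
have dX i : D (x ^+ i).
  by elim: i => [|i IH]; [rewrite expr0; exact: salg1|rewrite exprS; exact: salgM].
have [//|k [i ki] e] := @lin_dep n v (fun i => x ^+ i).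
  by move=> i; exact: hv.
exists (\sum_i k i *: 'X^i).
  apply: contra_neq ki => /(congr1 (fun A : {poly R[i]} => A`_i)).
  rewrite coef0 coef_sum (bigD1 i) //= big1 => [|j ji].
    by rewrite coefZ coefXn eqxx mulr1 addr0.
  by rewrite coefZ coefXn val_eqE eq_sym (negPf ji) mulr0.
rewrite raddf_sum -[RHS]e; apply: eq_bigr => j _.
by rewrite /= horner_algZ rmorphXn /= horner_algX.
Qed.

(** Over the algebraically closed field [R[i]] an annihilating polynomial of least degree splits.
    The list [rs] holds its roots with multiplicity; the strict inequality expresses minimality,
    since the product has size one more than [rs]. *)
Lemma minimal_poly D x : star_subalgebra D -> findim D -> D x ->
  exists rs : seq R[i], horner_alg x (\prod_(r <- rs) ('X - r%:P)) = 0 /\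
    forall A : {poly R[i]}, A != 0 -> horner_alg x A = 0 -> (size rs < size A)%N.
Proof.
move=> hD fD dx; have [A0 A00 xA0] := annihilating_poly hD fD dx.
pose P n := `[< exists A : {poly R[i]}, [/\ A != 0, horner_alg x A = 0 & size A = n] >].
have : exists n, P n by exists (size A0); apply/asboolP; exists A0.
move=> /ex_minnP[n /asboolP[A [An0 xA <-]] hmin].
have [rs e] := closed_field_poly_normal A.
have lA : lead_coef A != 0 by rewrite lead_coef_eq0.
exists rs; split=> [|B B0 xB].
  move: xA; rewrite e horner_algZ => /eqP; rewrite scaler_eq0 (negPf lA) /=.
  by move/eqP.
have /(leq_trans _) : (size A <= size B)%N by apply: hmin; apply/asboolP; exists B.
by apply; rewrite e size_scale // size_prod_XsubC.
Qed.


End StarAlgebra.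

Section PositiveFunctional.
Variables (R : realType) (T : cstarAlgType R) (tau : T -> R[i]).
Hypothesis tauS : state_on [set: T] tau.
Implicit Types (D : set T) (x y z : T) (c : R[i]).

Lemma tau_is_linear : forall c x y, tau (c *: x + y) = c * tau x + tau y.
Proof. by case: tauS => h _ _ c x y; apply: h. Qed.
Lemma tauD x y : tau (x + y) = tau x + tau y.
Proof. by have := tau_is_linear 1 x y; rewrite scale1r mul1r. Qed.
Lemma tau0 : tau 0 = 0.
Proof. by apply: (@addrI _ (tau 0)); rewrite -tauD !addr0. Qed.
Lemma tauZ c x : tau (c *: x) = c * tau x.
Proof. by have := tau_is_linear c x 0; rewrite tau0 !addr0. Qed.
Lemma tauN x : tau (- x) = - tau x.
Proof. by rewrite -scaleN1r tauZ mulN1r. Qed.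
Lemma tauB x y : tau (x - y) = tau x - tau y.
Proof. by rewrite tauD tauN. Qed.
Lemma tau_sum (I : Type) (s : seq I) (P : pred I) (F : I -> T) :
  tau (\sum_(i <- s | P i) F i) = \sum_(i <- s | P i) tau (F i).
Proof. by apply: big_morph; [exact: tauD|exact: tau0]. Qed.
Lemma tau_ge0 x : 0 <= tau (star x * x).
Proof. by case: tauS => _ h _; apply: h. Qed.
Lemma tau1 : tau 1 = 1. Proof. by case: tauS. Qed.

Lemma tau_star x : tau (star x) = (tau x)^*.
Proof.
(* Positivity at [1 + z] and at [z] makes the cross terms real; the cases [x] and ['i *: x] then
   determine both components. *)
have h z : complex.Im (tau z + tau (star z)) = 0.
  have := ger0_Im (tau_ge0 (1 + z)).
  rewrite raddfD /= star1 !mulrDl !mulrDr !mulr1 !mul1r !tauD tau1.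
  rewrite -[1]/((1 : R) +i* 0)%C.
  have := ger0_Im (tau_ge0 z).
  by case: (tau z) (tau (star z)) (tau (star z * z)) => [a b] [c d] [e f] /=; lra.
have := h x; have := h ('i *: x).
rewrite starZ !tauZ conjCi.
have -> : 'i = 'i%C :> R[i] by [].
have -> : (tau x)^* = ((tau x)^*)%C by [].
case: (tau x) (tau (star x)) => [a b] [c d] /=.
by rewrite !mul0r !mul1r => h1 h2; congr Complex; lra.
Qed.

(** Faithfulness of [tau] makes [tau (star y * x)] an inner product on [D], for which multiplication
    by [x] is symmetric. Hence the minimal polynomial has real simple roots, and the Lagrange
    polynomials at these roots, evaluated at [x], are the spectral projections. *)
Lemma spectral_ex D x : star_subalgebra D -> findim D -> faithful_on D tau ->
  D x -> star x = x ->
  exists n (l : 'I_n -> R) (p : 'I_n -> T),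
    [/\ spectral_resolution x l p, injective l, forall k, D (p k) & forall k, p k != 0].
Proof.
move=> hD fD tD dx xs; have [rs [xP Pmin]] := minimal_poly hD fD dx.
pose ha := horner_alg x.
have factor r : r \in rs -> \prod_(z <- rs) ('X - z%:P) =
    ('X - r%:P) * \prod_(z <- rem r rs) ('X - z%:P) :> {poly R[i]}.
  by move=> rin; rewrite (perm_big _ (perm_to_rem rin)) big_cons.
have haX r : ha ('X - r%:P) = x - r *: 1 by rewrite /ha rmorphB /= horner_algX horner_algC.
have prodD (s : seq R[i]) : \prod_(z <- s) ('X - z%:P) != 0 :> {poly R[i]}.
  by rewrite -size_poly_eq0 size_prod_XsubC.
have cof0 r : r \in rs -> ha (\prod_(z <- rem r rs) ('X - z%:P)) != 0.
  move=> rin; apply/eqP => /(Pmin _ (prodD _)).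
  by rewrite size_prod_XsubC size_rem // prednK ?ltnn //; case: (rs) rin.
(* The cofactor of a root gives an eigenvector [y], and [tau (star y * x * y)] is real. *)
have real_root r : r \in rs -> r^* = r.
  move=> rin; set y := ha (\prod_(z <- rem r rs) ('X - z%:P)).
  have dy : D y by apply: salg_horner.
  have xy : x * y = r *: y.
    have : ha (\prod_(z <- rs) ('X - z%:P)) = 0 by [].
    rewrite (factor r rin) /ha rmorphM /= -/ha haX -/y mulrBl -scalerAl mul1r.
    by move/eqP; rewrite subr_eq0 => /eqP.
  have y0 : tau (star y * y) != 0.
    by apply: contra_neq (cof0 _ rin) => /(tD _ dy).
  have e1 : tau (star y * x * y) = r * tau (star y * y).
    by rewrite -mulrA xy -scalerAr tauZ.
  have : (tau (star y * x * y))^* = tau (star y * x * y).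
    by rewrite -tau_star !starM starK xs mulrA.
  rewrite e1 rmorphM /= -[(tau _)^*]tau_star starM starK.
  exact: mulIf.
have rs_uniq : uniq rs.
  apply: count_mem_uniq => r; case rin: (r \in rs); last first.
    by apply/count_memPn; rewrite rin.
  rewrite (permP (perm_to_rem rin)) /= eqxx (_ : count_mem r _ = 0%N) //.
  apply/count_memPn; apply/negP => rin2.
  set q := \prod_(z <- rem r (rem r rs)) ('X - z%:P) : {poly R[i]}.
  have eq1 : \prod_(z <- rem r rs) ('X - z%:P) = ('X - r%:P) * q.
    by rewrite (perm_big _ (perm_to_rem rin2)) big_cons.
  (* A double root would make (x - r) q a nonzero vector of norm zero. *)
  have: ha (('X - r%:P) * (('X - r%:P) * q)) = 0 by rewrite -eq1 -factor.
  rewrite {1}/ha !rmorphM /= -/ha haX => e.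
  have := cof0 _ rin; rewrite eq1 {1}/ha rmorphM /= -/ha haX; case/eqP.
  apply: tD.
    rewrite -haX -[ha q]/(horner_alg x q) -rmorphM; exact: salg_horner.
  rewrite starM raddfB /= starZ star1 real_root // xs.
  by rewrite -!mulrA e mulr0 tau0.
have ha_eq (A B : {poly R[i]}) : {in rs, forall r, A.[r] = B.[r]} -> ha A = ha B.
  move=> AB; apply/eqP; rewrite -subr_eq0 /ha -rmorphB.
  have /dvdpP[q ->] : \prod_(z <- rs) ('X - z%:P) %| A - B.
    apply: uniq_roots_dvdp; last by rewrite uniq_rootsE.
    by apply/allP => r rin; rewrite rootE !hornerE AB ?subrr.
  by rewrite rmorphM /= xP mulr0.
pose n := size rs; pose r (k : 'I_n) := rs`_k.
have rin k : r k \in rs by rewrite mem_nth.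
have r_inj : injective r.
  by move=> i j /eqP; rewrite nth_uniq // => /eqP/val_inj.
pose l k := complex.Re (r k).
have lE k : (l k)%:C%C = r k by rewrite -conj_eq_rc // real_root.
pose Q k := \prod_(z <- rem (r k) rs) ('X - z%:P) : {poly R[i]}.
pose L k := (Q k).[r k]^-1 *: Q k.
have Q0 k : (Q k).[r k] != 0.
  by rewrite -rootE root_prod_XsubC mem_rem_uniq // inE eqxx.
have LE k j : (L k).[r j] = (j == k)%:R.
  rewrite hornerZ; have [->|jk] := eqVneq j k; first by rewrite mulVf.
  apply/eqP; rewrite mulf_eq0 invr_eq0 (negPf (Q0 _)) /= -rootE root_prod_XsubC.
  by rewrite mem_rem_uniq // inE rin andbT; apply: contra_neq jk => /r_inj.
have ha_eqr (A B : {poly R[i]}) : (forall j, A.[r j] = B.[r j]) -> ha A = ha B.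
  move=> AB; apply: ha_eq => z zin.
  have zi : (index z rs < n)%N by rewrite index_mem.
  by have := AB (Ordinal zi); rewrite /r /= nth_index.
exists n, l, (fun k => ha (L k)); split.
- split.
  + move=> k; rewrite /ha star_horner //; apply: ha_eqr => j.
    rewrite -[in LHS](real_root _ (rin j)) horner_map /= !LE.
    exact: conjC_nat.
  + move=> j k; rewrite /ha -rmorphM /=.
    have [->|jk] := eqVneq j k.
      by apply: ha_eqr => i; rewrite hornerM !LE -natrM mulnb andbb.
    rewrite -[RHS](rmorph0 (horner_alg x)); apply: ha_eqr => i.
    rewrite hornerM !LE -natrM mulnb horner0.
    by case: eqP => // ->; rewrite (negPf jk).
  + rewrite /ha -raddf_sum -(rmorph1 (horner_alg x)); apply: ha_eqr => i.
    rewrite horner_sum hornerC (bigD1 i) //= LE eqxx big1 ?addr0 // => j ji.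
    by rewrite LE eq_sym (negPf ji).
  + under eq_bigr => k _ do rewrite lE /ha -horner_algZ.
    rewrite -raddf_sum -{1}(horner_algX x); apply: ha_eqr => i.
    rewrite horner_sum hornerX (bigD1 i) //= hornerZ LE eqxx mulr1 big1 ?addr0 // => j ji.
    by rewrite hornerZ LE eq_sym (negPf ji) mulr0.
- by move=> i j e; apply: r_inj; rewrite -!lE e.
- by move=> k; apply: salg_horner.
- move=> k; rewrite /L /ha horner_algZ scaler_eq0 invr_eq0 (negPf (Q0 k)) /=.
  exact: cof0.
Qed.

End PositiveFunctional.

                            

(** * Functional calculus and positive definite elements *)

Section FunctionalCalculus.
Variables (R : realType) (T : cstarAlgType R).
Implicit Types (D : set T) (x y z : T) (f g : R -> R).

(** Arbitrary finite index types are allowed because a joint resolution of two commuting elements is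
    indexed by pairs. *)
Definition resolution (J : finType) x (l : J -> R) (p : J -> T) : Prop :=
  [/\ forall k, star (p k) = p k,
      forall j k, p j * p k = if j == k then p k else 0,
      \sum_k p k = 1 &
      x = \sum_k (l k)%:C%C *: p k].

Definition calc (J : finType) f (l : J -> R) (p : J -> T) : T :=
  \sum_k (f (l k))%:C%C *: p k.

Lemma resolution_mul (J : finType) x l (p : J -> T) k :
  resolution x l p -> x * p k = (l k)%:C%C *: p k.
Proof.
case=> _ pp _ ->; rewrite mulr_suml (bigD1 k) //= big1 => [|j jk].
  by rewrite -scalerAl pp eqxx addr0.
by rewrite -scalerAl pp (negPf jk) scaler0.
Qed.

Lemma resolution_mulr (J : finType) x l (p : J -> T) k :
  resolution x l p -> p k * x = (l k)%:C%C *: p k.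
Proof.
case=> _ pp _ ->; rewrite mulr_sumr (bigD1 k) //= big1 => [|j jk].
  by rewrite -scalerAr pp eqxx addr0.
by rewrite -scalerAr pp eq_sym (negPf jk) scaler0.
Qed.

Lemma resolution_calc (J : finType) x f l (p : J -> T) :
  resolution x l p -> resolution (calc f l p) (f \o l) p.
Proof. by case. Qed.

                                                                         
(** If x y = y x', the block p_j y q_k vanishes unless l_j = m_k, so f(l_j) and f(m_k) act alike on
    every block. With y = 1 this is independence of the resolution; with x' = x it is commutation
    with functions of [x]. *)
Lemma calc_intertwine (J K : finType) x x' y f l (p : J -> T) m (q : K -> T) :
  resolution x l p -> resolution x' m q -> x * y = y * x' ->
  calc f l p * y = y * calc f m q.
Proof.
move=> rx rx' xy.
have key j k : (f (l j))%:C%C *: (p j * y * q k) = (f (m k))%:C%C *: (p j * y * q k).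
  have [-> //|jk] := eqVneq (l j) (m k).
  suff -> : p j * y * q k = 0 by rewrite !scaler0.
  apply/eqP; have : (l j)%:C%C *: (p j * y * q k) = (m k)%:C%C *: (p j * y * q k).
    rewrite scalerAl scalerAl -(resolution_mulr _ rx) -[p j * x * y]mulrA xy.
    by rewrite -!mulrA (resolution_mul _ rx') -!scalerAr.
  move/eqP; rewrite -subr_eq0 -scalerBl scaler_eq0 => /orP[|//].
  by rewrite subr_eq0 => /eqP/complexI/eqP; rewrite (negPf jk).
have [_ _ p1 _] := rx; have [_ _ q1 _] := rx'.
rewrite -[LHS]mulr1 -q1 -[RHS]mul1r -p1 !mulr_suml.
apply: eq_bigr => j _; rewrite !mulr_sumr; apply: eq_bigr => k _.
by rewrite -!scalerAl -!scalerAr mulrA key.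
Qed.

Lemma calc_unique (J K : finType) x f l (p : J -> T) m (q : K -> T) :
  resolution x l p -> resolution x m q -> calc f l p = calc f m q.
Proof.
move=> rx rx'; have := @calc_intertwine _ _ _ _ 1 f _ _ _ _ rx rx'.
by rewrite !mulr1 !mul1r; apply.
Qed.

(** Any resolution computes the element chosen by [xget], by [calc_unique]; enumerating [J] supplies
    the ordinal-indexed witness. *)
Lemma funcalcE (J : finType) x f l (p : J -> T) :
  resolution x l p -> funcalc f x = calc f l p.
Proof.
move=> rx; rewrite /funcalc; set S := [set y | _].
have [n [m [q [rq ->]]]] : S (xget 0 S); last exact: (calc_unique _ rq rx).
apply: (@xgetPex _ 0 S); exists (calc f l p).
exists #|J|, (l \o enum_val), (p \o enum_val); rewrite /calc.
have [ps pp p1 xE] := rx.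
have bij : bijective (@enum_val J J) by exists enum_rank; [exact: enum_valK|exact: enum_rankK].
have re (V : nmodType) (F : J -> V) : \sum_k F k = \sum_(i < #|J|) F (enum_val i).
  by rewrite (reindex _ (onW_bij _ bij)).
split; last by rewrite re.
split=> [k|j k||] /=; rewrite ?ps ?pp -?re //.
  by rewrite (inj_eq enum_val_inj).
by rewrite xE (re _ (fun k => (l k)%:C%C *: p k)).
Qed.

(** Positive definite elements of [D]. Distinct eigenvalues make each projection a function of [x],
    so that whatever commutes with [x] commutes with it. *)
Definition spd D x : Prop :=
  exists n (l : 'I_n -> R) (p : 'I_n -> T),
    [/\ resolution x l p, injective l, forall k, D (p k) & forall k, 0 < l k].

Lemma calcM (J : finType) x f g l (p : J -> T) : resolution x l p ->
  calc f l p * calc g l p = calc (fun t => f t * g t) l p.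
Proof.
move=> [_ pp _ _]; rewrite mulr_suml; apply: eq_bigr => j _.
rewrite mulr_sumr (bigD1 j) //= big1 => [|k kj].
  by rewrite -scalerAl -scalerAr scalerA pp eqxx addr0 rmorphM.
by rewrite -scalerAl -scalerAr pp eq_sym (negPf kj) !scaler0.
Qed.

Lemma star_calc (J : finType) x f l (p : J -> T) : resolution x l p ->
  star (calc f l p) = calc f l p.
Proof.
by move=> [ps _ _ _]; rewrite raddf_sum; apply: eq_bigr => k _; rewrite /= starZr ps.
Qed.

Lemma calc1 (J : finType) x l (p : J -> T) : resolution x l p ->
  calc (fun=> 1) l p = 1.
Proof.
by move=> [_ _ <- _]; apply: eq_bigr => k _; rewrite rmorph1 scale1r.
Qed.

Lemma eq_calc (J : finType) f g l (p : J -> T) :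
  (forall k, f (l k) = g (l k)) -> calc f l p = calc g l p.
Proof. by move=> h; apply: eq_bigr => k _; rewrite h. Qed.

Lemma spd_sa D x : spd D x -> star x = x.
Proof.
by move=> [n [l [p [rx _ _ _]]]]; have := star_calc id rx; case: rx => _ _ _ ->.
Qed.

Lemma spd_subset D E x : D `<=` E -> spd D x -> spd E x.
Proof.
by move=> DE [n [l [p [? ? pD ?]]]]; exists n, l, p; split=> // k; apply/DE/pD.
Qed.

Section Powers.
Variables (D : set T) (hD : star_subalgebra D) (x : T) (hx : spd D x).

Lemma funcalc_in f : D (funcalc f x).
Proof.
have [n [l [p [rx _ pD _]]]] := hx; rewrite (funcalcE f rx).
by apply: salg_sum => // k _; apply: salgZ.
Qed.

Lemma spd_in : D x.
Proof.
have [n [l [p [[_ _ _ ->] _ pD _]]]] := hx.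
by apply: salg_sum => // k _; apply: salgZ.
Qed.

Lemma funcalcM f g : funcalc f x * funcalc g x = funcalc (fun t => f t * g t) x.
Proof.
by have [n [l [p [rx _ _ _]]]] := hx; rewrite !(funcalcE _ rx) (calcM _ _ rx).
Qed.

Lemma star_funcalc f : star (funcalc f x) = funcalc f x.
Proof.
by have [n [l [p [rx _ _ _]]]] := hx; rewrite (funcalcE _ rx) (star_calc _ rx).
Qed.

Lemma eq_funcalc f g : (forall t, 0 < t -> f t = g t) -> funcalc f x = funcalc g x.
Proof.
have [n [l [p [rx _ _ l0]]]] := hx => fg; rewrite !(funcalcE _ rx).
by apply: eq_calc => k; apply: fg.
Qed.

Lemma funcalc_id : funcalc id x = x.
Proof.
by have [n [l [p [rx _ _ _]]]] := hx; rewrite (funcalcE _ rx); case: rx => _ _ _ ->.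
Qed.

Lemma funcalc1 : funcalc (fun=> 1) x = 1.
Proof.
by have [n [l [p [rx _ _ _]]]] := hx; rewrite (funcalcE _ rx) (calc1 rx).
Qed.

Lemma funcalc_comm f y : x * y = y * x -> funcalc f x * y = y * funcalc f x.
Proof.
have [n [l [p [rx _ _ _]]]] := hx => xy; rewrite !(funcalcE _ rx).
exact: (calc_intertwine _ rx rx xy).
Qed.

Lemma spd_funcalc f : (forall t, 0 < t -> 0 < f t) ->
  {in [pred t | 0 < t] &, injective f} -> spd D (funcalc f x).
Proof.
have [n [l [p [rx li pD l0]]]] := hx => f0 fi; exists n, (f \o l), p.
rewrite (funcalcE _ rx); split=> // [|j k /= e|k]; first exact: resolution_calc rx.
- by apply: li; apply: fi; rewrite ?inE.
- exact: f0.
Qed.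

Definition pwr (k : int) : T := funcalc (fun t => t ^ k) x.

Lemma pwrD j k : pwr (j + k) = pwr j * pwr k.
Proof.
by rewrite funcalcM; apply: eq_funcalc => t t0; rewrite expfzDr ?gt_eqF.
Qed.

Lemma pwr0 : pwr 0 = 1.
Proof. by rewrite -funcalc1; apply: eq_funcalc => t _; rewrite expr0z. Qed.

Lemma pwr1 : pwr 1 = x.
Proof. by rewrite -[RHS]funcalc_id; apply: eq_funcalc => t _; rewrite expr1z. Qed.

Lemma star_pwr k : star (pwr k) = pwr k. Proof. exact: star_funcalc. Qed.

Lemma pwrNK k : pwr k * pwr (- k) = 1.
Proof. by rewrite -pwrD subrr pwr0. Qed.

Lemma pwrKN k : pwr (- k) * pwr k = 1.
Proof. by rewrite -pwrD addNr pwr0. Qed.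

Lemma mulxV : x * pwr (-1) = 1.
Proof. by rewrite -{1}pwr1 pwrNK. Qed.

Lemma mulVx : pwr (-1) * x = 1.
Proof. by rewrite -[X in _ * X]pwr1 pwrKN. Qed.

Lemma spd_inv : spd D (pwr (-1)).
Proof.
apply: spd_funcalc => [t t0|s t _ _]; first by rewrite exprN1 invr_gt0.
by rewrite !exprN1 => /invr_inj.
Qed.

Lemma spd_sqrt : exists z,
  [/\ spd D z, x = z * z & forall y, x * y = y * x -> z * y = y * z].
Proof.
exists (funcalc (@Num.sqrt R) x); split; last by move=> y; exact: funcalc_comm.
  apply: spd_funcalc => [t t0|s t s0 t0]; first by rewrite sqrtr_gt0.
  by move/eqP; rewrite eqr_sqrt ?ltW // => /eqP.
rewrite funcalcM -[LHS]funcalc_id; apply: eq_funcalc => t t0.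
by rewrite -expr2 sqr_sqrtr // ltW.
Qed.

Lemma spd_positive_in : positive_in D x.
Proof.
have [z [zs -> _]] := spd_sqrt; exists z; last by rewrite (spd_sa zs).
have [n [l [p [[_ _ _ ->] _ pD _]]]] := zs.
by apply: salg_sum => // k _; apply: salgZ.
Qed.

End Powers.

(** The spectral projections of [x] and [y] commute, their products resolve [x * y] with eigenvalues
    l_i u_j, and ln is additive on these. *)
Lemma funcalc_ln_mul D E x y : spd D x -> spd E y -> x * y = y * x ->
  funcalc (@ln R) (x * y) = funcalc (@ln R) x + funcalc (@ln R) y.
Proof.
move=> [n [l [p [rx li _ l0]]]] [m [u [q [ry ui _ u0]]]] xy.
have pE k : p k = calc (fun t => (t == l k)%:R) l p.
  rewrite /calc (bigD1 k) //= eqxx scale1r big1 ?addr0 // => j jk.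
  by rewrite (inj_eq li) (negPf jk) scale0r.
have qE k : q k = calc (fun t => (t == u k)%:R) u q.
  rewrite /calc (bigD1 k) //= eqxx scale1r big1 ?addr0 // => j jk.
  by rewrite (inj_eq ui) (negPf jk) scale0r.
have pq j k : p j * q k = q k * p j.
  rewrite [p j]pE; apply: (calc_intertwine _ rx rx).
  rewrite [q k]qE; symmetry; apply: (calc_intertwine _ ry ry); exact/esym.
have [ps pp p1 xE] := rx; have [qs qq q1 yE] := ry.
have big2 (V : nmodType) (F : 'I_n -> 'I_m -> V) :
    \sum_(k : 'I_n * 'I_m) F k.1 k.2 = \sum_i \sum_j F i j.
  by rewrite pair_bigA.
have rxy : resolution (x * y) (fun k : 'I_n * 'I_m => l k.1 * u k.2)
    (fun k => p k.1 * q k.2).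
  split=> [k|[a b] [c d] /=||].
  + by rewrite starM ps qs pq.
  + rewrite mulrA -[p a * q b * p c]mulrA -pq mulrA pp -mulrA qq xpair_eqE.
    by case: (a == c); case: (b == d); rewrite /= ?mulr0 ?mul0r.
  + rewrite (big2 _ (fun i j => p i * q j)) -[RHS]mulr1 -{1}p1 -q1 mulr_suml.
    by apply: eq_bigr => i _; rewrite mulr_sumr.
  + rewrite (big2 _ (fun i j => (l i * u j)%:C%C *: (p i * q j))) xE yE mulr_suml.
    apply: eq_bigr => i _; rewrite mulr_sumr; apply: eq_bigr => j _.
    by rewrite -scalerAl -scalerAr scalerA rmorphM.
rewrite (funcalcE _ rxy) (funcalcE _ rx) (funcalcE _ ry) /calc.
rewrite (big2 _ (fun i j => (ln (l i * u j))%:C%C *: (p i * q j))).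
have -> : \sum_k (ln (l k))%:C%C *: p k =
    \sum_i \sum_j (ln (l i))%:C%C *: (p i * q j).
  by apply: eq_bigr => i _; rewrite -scaler_sumr -mulr_sumr q1 mulr1.
have -> : \sum_k (ln (u k))%:C%C *: q k =
    \sum_i \sum_j (ln (u j))%:C%C *: (p i * q j).
  rewrite exchange_big /=.
  by apply: eq_bigr => j _; rewrite -scaler_sumr -mulr_suml p1 mul1r.
rewrite -big_split; apply: eq_bigr => i _; rewrite -big_split; apply: eq_bigr => j _ /=.
by rewrite lnM ?posrE // rmorphD scalerDl.
Qed.

End FunctionalCalculus.

(** * Finite-dimensional subalgebras with faithful trace *)

Section FiniteDimensional.
Variables (R : realType) (T : cstarAlgType R) (tau : T -> R[i]).
Hypothesis tauS : state_on [set: T] tau.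
Implicit Types (D V : set T) (x y z : T).

Definition fdalg D : Prop :=
  [/\ star_subalgebra D, findim D & faithful_on D tau].

Lemma fdalg_subset D V : fdalg D -> star_subalgebra V -> V `<=` D -> fdalg V.
Proof.
move=> [_ [n [v hv]] tD] hV VD; split=> //; last by move=> x /VD; apply: tD.
by exists n, v => x /VD; apply: hv.
Qed.

Lemma fdalg_gt0 D x : fdalg D -> D x -> x != 0 -> 0 < tau (star x * x).
Proof.
move=> [_ _ tD] dx x0; rewrite lt_def (tau_ge0 tauS) andbT.
by apply: contra_neq x0; apply: tD.
Qed.

(** Tested on the spectral projections, the hypothesis says that every eigenvalue is positive. *)
Lemma spdP D x : fdalg D -> D x -> star x = x ->
  (forall v, D v -> v != 0 -> 0 < tau (star v * x * v)) -> spd D x.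
Proof.
move=> hD dx xs x0; have [hD' fD tD] := hD.
have [n [l [p [rx li pD p0]]]] := spectral_ex tauS hD' fD tD dx xs.
exists n, l, p; split=> // k; have [ps pp _ _] := rx.
have := x0 _ (pD k) (p0 k).
rewrite -mulrA (resolution_mul k rx) -scalerAr (tauZ tauS).
by rewrite pmulr_lgt0 ?ltcR ?(fdalg_gt0 hD).
Qed.

Lemma spd_gram D z z' : fdalg D -> D z -> z' * z = 1 -> spd D (star z * z).
Proof.
move=> hD dz z'z; have [hD' _ _] := hD; apply: spdP => //.
- by apply: salgM => //; apply: salg_star.
- by rewrite starM starK.
- move=> v dv v0; rewrite mulrA -starM -mulrA; apply: (fdalg_gt0 hD).
    exact: salgM.
  by apply: contra_neq v0 => /(congr1 ( *%R z')); rewrite mulrA z'z mul1r mulr0.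
Qed.

Lemma spd_gt0 D E x v : fdalg D -> spd D x -> E `<=` D -> E v -> v != 0 ->
  0 < tau (star v * x * v).
Proof.
move=> hD hx ED ev v0; have [z [hz -> _]] := spd_sqrt hx; have [hD' _ _] := hD.
rewrite -{1}(spd_sa hz) mulrA -starM -mulrA; apply: (fdalg_gt0 hD).
  by apply: salgM => //; [exact: spd_in hz|exact: ED].
apply: contra_neq v0 => /(congr1 ( *%R (pwr z (-1)))).
by rewrite mulrA -{2}(pwr1 hz) (pwrKN hz) mul1r mulr0.
Qed.

Lemma spdM D x y : fdalg D -> spd D x -> spd D y -> x * y = y * x -> spd D (x * y).
Proof.
move=> hD hx hy xy; have [hD' _ _] := hD.
have [z [hz zE zC]] := spd_sqrt hx; have [u [hu uE uC]] := spd_sqrt hy.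
have zu : z * u = u * z by symmetry; apply/uC/esym/zC.
have -> : x * y = star (z * u) * (z * u).
  rewrite starM (spd_sa hz) (spd_sa hu) zE uE -[in RHS]zu.
  by rewrite -!mulrA; congr (_ * _); rewrite !mulrA -zu.
apply: (@spd_gram _ _ (pwr u (-1) * pwr z (-1))) => //.
  by apply: salgM => //; [exact: spd_in hz|exact: spd_in hu].
rewrite -mulrA [pwr z _ * _]mulrA -{2}(pwr1 hz) (pwrKN hz) mul1r.
by rewrite -{2}(pwr1 hu) (pwrKN hu).
Qed.

Lemma trace_ext D x y : fdalg D -> D x -> D y ->
  (forall z, D z -> tau (x * z) = tau (y * z)) -> x = y.
Proof.
move=> [hD _ tD] dx dy h; apply/eqP; rewrite -subr_eq0; apply/eqP.
rewrite -[LHS]starK -[RHS](raddf0 (@star R T)); congr star.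
have ds : D (star (x - y)) by apply: salg_star => //; apply: salgB.
by apply: tD => //; rewrite starK mulrBl (tauB tauS) h ?subrr.
Qed.

(** The element [h] is the trace-preserving conditional expectation of [b], obtained by expanding
    along a maximal family orthogonal for [tau (star x * y)]. Every density and marginal below comes
    from here. *)
Lemma riesz V b : fdalg V -> exists2 h, V h & forall x, V x -> tau (h * x) = tau (b * x).
Proof.
move=> hV; have [hV' [N [e he]] tV] := hV.
pose orth (s : seq T) := (forall i, (i < size s)%N -> V s`_i /\ s`_i != 0) /\
  (forall i j, (i < size s)%N -> (j < size s)%N -> i != j -> tau (star s`_i * s`_j) = 0).
have bound s : orth s -> (size s <= N)%N.
  move=> [s0 so]; rewrite leqNgt; apply/negP => sN.
  have lt (i : 'I_N.+1) : (i < size s)%N by apply: leq_trans (ltn_ord i) sN.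
  have [|k [i /eqP ki] k0] := @lin_dep _ T N e (fun i => s`_i).
    by move=> i; apply: he; have [] := s0 i (lt i).
  have [vi si] := s0 i (lt i).
  have := congr1 (fun z => tau (star s`_i * z)) k0.
  rewrite mulr0 (tau0 tauS) mulr_sumr (tau_sum tauS) (bigD1 i) //= big1 => [|j ji].
    rewrite addr0 -scalerAr (tauZ tauS) => /eqP; rewrite mulf_eq0 => /orP[/eqP //|].
    by rewrite gt_eqF // (fdalg_gt0 hV).
  by rewrite -scalerAr (tauZ tauS) so ?mulr0 ?lt // eq_sym.
pose P n := `[< exists2 s, orth s & size s = n >].
have exP : exists n, P n by exists 0%N; apply/asboolP; exists [::].
have ubP n : P n -> (n <= N)%N by move=> /asboolP[s /bound ? <-].
have [n /asboolP[s [s0 so] <-] smax] := ex_maxnP exP ubP.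
pose nrm i := tau (star s`_i * s`_i).
have nrm0 i : (i < size s)%N -> nrm i != 0.
  by move=> /s0[vi si]; rewrite gt_eqF // (fdalg_gt0 hV).
(* A nonzero remainder of the orthogonal expansion would enlarge the maximal family. *)
have expand x : V x ->
    x = \sum_(i < size s) (tau (star s`_i * x) / nrm i) *: s`_i.
  move=> vx; apply/eqP; rewrite -subr_eq0; set r := x - _; apply: contraT => r0.
  have vr : V r.
    by apply: salgB => //; apply: salg_sum => // i _; apply: salgZ => //; case: (s0 i).
  have ro i : (i < size s)%N -> tau (star s`_i * r) = 0.
    move=> li; rewrite mulrBr (tauB tauS) mulr_sumr (tau_sum tauS).
    rewrite (bigD1 (Ordinal li)) //= big1 => [|j ji].
      by rewrite addr0 -scalerAr (tauZ tauS) divfK ?subrr // nrm0.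
    rewrite -scalerAr (tauZ tauS) so ?mulr0 //.
    by apply: contra_neq ji => e1; apply: val_inj.
  suff /smax : P (size (r :: s)) by rewrite ltnn.
  apply/asboolP; exists (r :: s) => //; split=> [[|i] //|[|i] [|j] //] /=.
  - by rewrite ltnS => li; apply: s0.
  - move=> _; rewrite ltnS => lj _; have := ro _ lj.
    by move/(congr1 Num.conj); rewrite -(tau_star tauS) starM starK rmorph0.
  - by rewrite ltnS => li _ _; apply: ro.
  - by rewrite !ltnS => li lj ij; apply: so.
exists (\sum_(i < size s) (tau (b * s`_i) / nrm i) *: star s`_i).
  by apply: salg_sum => // i _; apply: salgZ => //; apply: salg_star => //; case: (s0 i).
move=> x vx; rewrite {2}(expand x vx) mulr_suml mulr_sumr !(tau_sum tauS).
apply: eq_bigr => i _; rewrite -scalerAl -scalerAr !(tauZ tauS).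
by rewrite mulrAC [RHS]mulrC mulrA.
Qed.

End FiniteDimensional.

                          

(** * Norm limits, and the local algebras as Clifford algebras *)

Section NormConvergence.
Variables (R : realType) (T : cstarAlgType R).
Implicit Types (x y z : T) (u v : nat -> T).

Lemma cnorm0 : cnorm (0 : T) = 0.
Proof.
by have := cnormZ 0 (0 : T); rewrite scale0r normr0 mul0r => /complexI.
Qed.

Lemma cnormN x : cnorm (- x) = cnorm x.
Proof.
by have := cnormZ (-1) x; rewrite scaleN1r normrN1 mul1r => /complexI.
Qed.

Lemma cnorm_ge0 x : 0 <= cnorm x.
Proof. by have := cnormD x (- x); rewrite subrr cnorm0 cnormN; lra. Qed.

Lemma cnorm1 : cnorm (1 : T) = 1.
Proof.
have := cnorm_star (1 : T); rewrite star1 mulr1 => /eqP.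
rewrite expr2 -{1}[cnorm 1]mulr1 eq_sym -subr_eq0 -mulrBr mulf_eq0 => /orP[/eqP /cnorm_eq0/eqP|].
  by rewrite oner_eq0.
by rewrite subr_eq0 => /eqP.
Qed.

Definition cvto u x : Prop := (fun n => cnorm (u n - x)) @ \oo --> (0 : R).

Lemma cvto_le u x (v : nat -> R) : (forall n, cnorm (u n - x) <= v n) ->
  v @ \oo --> (0 : R) -> cvto u x.
Proof.
move=> uv v0; apply: (squeeze_cvgr _ (cvg_cst 0) v0).
by apply: nearW => n; rewrite cnorm_ge0 uv.
Qed.

Lemma cvtoMl y u x : cvto u x -> cvto (fun n => y * u n) (y * x).
Proof.
move=> ux; apply: (@cvto_le _ _ (fun n => cnorm y * cnorm (u n - x))).
  by move=> n; rewrite -mulrBr cnormM.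
by rewrite -[X in _ --> X](mulr0 (cnorm y)); apply: cvgM => //; exact: cvg_cst.
Qed.

Lemma cvtoMr y u x : cvto u x -> cvto (fun n => u n * y) (x * y).
Proof.
move=> ux; apply: (@cvto_le _ _ (fun n => cnorm (u n - x) * cnorm y)).
  by move=> n; rewrite -mulrBl cnormM.
by rewrite -[X in _ --> X](mul0r (cnorm y)); apply: cvgM => //; exact: cvg_cst.
Qed.

Lemma cvtoD u v x y : cvto u x -> cvto v y -> cvto (fun n => u n + v n) (x + y).
Proof.
move=> ux vy; apply: (@cvto_le _ _ (fun n => cnorm (u n - x) + cnorm (v n - y))).
  by move=> n; rewrite opprD addrACA cnormD.
by rewrite -[X in _ --> X](addr0 0); apply: cvgD.
Qed.

Lemma cvto_unique u x y : cvto u x -> cvto u y -> x = y.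
Proof.
move=> ux uy; apply/eqP; rewrite -subr_eq0; apply/eqP/cnorm_eq0.
have h : (fun n => cnorm (u n - x) + cnorm (u n - y)) @ \oo --> (0 : R).
  by rewrite -[X in _ --> X](addr0 0); apply: cvgD.
apply/eqP; rewrite eq_le cnorm_ge0 andbT.
apply: (ler_cvg_to (cvg_cst _) h); apply: nearW => n.
rewrite -[cnorm (u n - x)]cnormN; apply: le_trans (cnormD _ _).
by rewrite opprB addrA subrK.
Qed.

Lemma cauchy_real (c : nat -> R) :
  (forall e, 0 < e -> exists N, forall m n, (N <= m)%N -> (N <= n)%N -> `|c m - c n| < e) ->
  exists l : R, c @ \oo --> l.
Proof.
move=> h; suff /cauchy_cvg/cvg_ex[l cl] : cauchy (c @ \oo) by exists l.
apply/cauchyP => e e0.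
have [N hN] := h e e0; exists (c N); exists N => // n /= Nn.
by rewrite /ball /=; apply: hN => //=.
Qed.

(** The norm of a scalar multiple of 1 bounds both components of the scalar, which therefore form
    real Cauchy sequences. This is the base case of [cliff_norm_closed]. *)
Lemma scalars_norm_closed : norm_closed [set x : T | exists c : R[i], x = c *: 1].
Proof.
move=> u x /choice[c uE] ux.
have cn (d : R[i]) : (cnorm (d *: (1 : T)))%:C%C = `|d|.
  by rewrite cnormZ cnorm1 mulr1.
have re_le (d : R[i]) : `|complex.Re d| <= cnorm (d *: (1 : T)).
  rewrite -lecR cn normc_def lecR -sqrtr_sqr; apply: ler_wsqrtr.
  by rewrite lerDl sqr_ge0.
have im_le (d : R[i]) : `|complex.Im d| <= cnorm (d *: (1 : T)).
  rewrite -lecR cn normc_def lecR -sqrtr_sqr; apply: ler_wsqrtr.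
  by rewrite lerDr sqr_ge0.
have cauchy e : 0 < e -> exists N, forall m n, (N <= m)%N -> (N <= n)%N ->
    cnorm ((c m - c n) *: (1 : T)) < e.
  move=> e0; have e2 : 0 < e / 2 by rewrite divr_gt0.
  have /cvgrPdist_lt /(_ _ e2) [N _ hN] := ux.
  exists N => m n /hN hm /hN hn; rewrite scalerBl -!uE.
  move: hm hn; rewrite /= !sub0r !normrN !ger0_norm ?cnorm_ge0 // => hm hn.
  rewrite -[u m - u n](_ : (u m - x) + - (u n - x) = _); last first.
    by rewrite opprB addrA subrK.
  by apply: le_lt_trans (cnormD _ _) _; rewrite cnormN; lra.
have [r hr] : exists l : R, (fun n => complex.Re (c n)) @ \oo --> l.
  apply: cauchy_real => e /cauchy[N hN]; exists N => m n hm hn.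
  apply: le_lt_trans (hN _ _ hm hn); apply: le_trans (re_le _).
  by case: (c m) (c n) => [? ?] [? ?].
have [s hs] : exists l : R, (fun n => complex.Im (c n)) @ \oo --> l.
  apply: cauchy_real => e /cauchy[N hN]; exists N => m n hm hn.
  apply: le_lt_trans (hN _ _ hm hn); apply: le_trans (im_le _).
  by case: (c m) (c n) => [? ?] [? ?].
exists (r +i* s)%C; apply: (cvto_unique ux).
apply: (@cvto_le _ _ (fun n => `|complex.Re (c n) - r| + `|complex.Im (c n) - s|)).
  move=> n; rewrite uE -scalerBl -lecR cn rmorphD /=.
  have -> : c n - (r +i* s)%C = (complex.Re (c n) - r)%:C%C + 'i * (complex.Im (c n) - s)%:C%C.
    have -> : 'i = 'i%C :> R[i] by [].
    by rewrite [LHS]complexE; case: (c n).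
  apply: le_trans (ler_normD _ _) _; rewrite normrM normCi mul1r.
  by rewrite !normc_def /= expr0n /= !addr0 !sqrtr_sqr.
rewrite -[X in _ --> X](addr0 0); apply: cvgD.
  by apply/norm_cvg0P/subr_cvg0.
by apply/norm_cvg0P/subr_cvg0.
Qed.

End NormConvergence.

Section Clifford.
Variables (R : realType) (T : cstarAlgType R) (I : eqType) (e : I -> T).
Hypothesis e_star : forall i, star (e i) = e i.
Hypothesis e_sq : forall i, e i * e i = 1.
Hypothesis e_anti : forall i j, i != j -> e i * e j = - (e j * e i).
Hypothesis e_fresh : forall s : seq I, exists j, j \notin s.
Implicit Types (s t : seq I) (x y z : T) (i j k : I).

(** For distinct indices this is the span of the ordered monomials in the generators of [s]. Peeling
    off one generator at a time lets closure, dimension, trace and expectation all be treated by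
    induction on the list. *)
Fixpoint cliff s : set T :=
  if s is i :: s' then
    [set x | exists y z, [/\ cliff s' y, cliff s' z & x = y + z * e i]]
  else [set x | exists c : R[i], x = c *: 1].

Lemma cliffP s c x y : cliff s x -> cliff s y -> cliff s (c *: x + y).
Proof.
elim: s x y => [|i s IH] x y /=.
  by move=> [a ->] [b ->]; exists (c * a + b); rewrite scalerDl scalerA.
move=> [u [v [hu hv ->]]] [u' [v' [hu' hv' ->]]].
exists (c *: u + u'), (c *: v + v'); split; [exact: IH|exact: IH|].
by rewrite scalerDr mulrDl -scalerAl addrACA.
Qed.

Lemma cliff1 s : cliff s 1.
Proof.
elim: s => [|i s IH] /=; first by exists 1; rewrite scale1r.
exists 1, 0; split=> //; last by rewrite mul0r addr0.
by have := cliffP (-1) IH IH; rewrite scaleN1r addNr.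
Qed.

Lemma cliff0 s : cliff s 0.
Proof. by have := cliffP (-1) (cliff1 s) (cliff1 s); rewrite scaleN1r addNr. Qed.

Lemma cliffD s x y : cliff s x -> cliff s y -> cliff s (x + y).
Proof. by move=> hx hy; have := cliffP 1 hx hy; rewrite scale1r. Qed.

Lemma cliffN s x : cliff s x -> cliff s (- x).
Proof. by move=> hx; have := cliffP (-1) hx (cliff0 s); rewrite scaleN1r addr0. Qed.

Lemma cliff_cons i s x : cliff s x -> cliff (i :: s) x.
Proof.
by move=> hx; exists x, 0; split=> //; [exact: cliff0|rewrite mul0r addr0].
Qed.

Lemma cliff_gen i s : i \in s -> cliff s (e i).
Proof.
elim: s => [//|k s IH]; rewrite inE => /orP[/eqP <-|/IH]; last exact: cliff_cons.
by exists 0, 1; split; [exact: cliff0|exact: cliff1|rewrite mul1r add0r].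
Qed.

Lemma cliff_conj i s x : i \notin s -> cliff s x -> cliff s (e i * x * e i).
Proof.
elim: s x => [|k s IH] x; first by
  move=> _ [c ->]; exists c; rewrite -scalerAr mulr1 -scalerAl e_sq.
rewrite inE negb_or => /andP[ik ins] [u [v [hu hv ->]]].
exists (e i * u * e i), (- (e i * v * e i)); split; [exact: IH| |].
  by apply/cliffN/IH.
rewrite mulrDr mulrDl; congr (_ + _).
by rewrite mulNr -!mulrA (e_anti ik) !mulrN opprK.
Qed.

Lemma cliff_swap i s x : i \notin s -> cliff s x -> exists2 y, cliff s y & e i * x = y * e i.
Proof.
move=> ins hx; exists (e i * x * e i); first exact: cliff_conj.
by rewrite -mulrA e_sq mulr1.
Qed.

Lemma cliffM s x y : uniq s -> cliff s x -> cliff s y -> cliff s (x * y).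
Proof.
elim: s x y => [|i s IH] x y /=.
  by move=> _ [a ->] [b ->]; exists (a * b); rewrite -scalerAl mul1r scalerA.
move=> /andP[ins us] [u [v [hu hv ->]]] [u' [v' [hu' hv' ->]]].
have [p hp pE] := cliff_swap ins hu'; have [q hq qE] := cliff_swap ins hv'.
exists (u * u' + v * q), (u * v' + v * p); split.
- by apply: cliffD; apply: IH.
- by apply: cliffD; apply: IH.
- rewrite mulrDl !mulrDr -[v * e i * u']mulrA pE.
  rewrite -[v * e i * (v' * e i)]mulrA [e i * (v' * _)]mulrA qE -[q * _ * _]mulrA e_sq mulr1.
  by rewrite mulrDl -!mulrA -!addrA; congr (_ + _); rewrite addrA addrC.
Qed.

Lemma cliff_star s x : uniq s -> cliff s x -> cliff s (star x).
Proof.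
elim: s x => [|i s IH] x /=.
  by move=> _ [c ->]; exists (c^*); rewrite starZ star1.
move=> /andP[ins us] [u [v [hu hv ->]]].
have [p hp pE] := cliff_swap ins (IH _ us hv).
by exists (star u), p; split=> //; [exact: IH|rewrite raddfD /= starM e_star pE].
Qed.

Lemma cliff_star_subalgebra s : uniq s -> star_subalgebra (cliff s).
Proof.
move=> us; split; [exact: cliff1|exact: cliffP|by move=> x y; exact: cliffM|].
by move=> x; exact: cliff_star.
Qed.

Lemma cliff_mono s t x : uniq t -> {subset s <= t} -> cliff s x -> cliff t x.
Proof.
move=> ut; elim: s x => [|i s IH] x st /=.
  by move=> [c ->]; apply: salgZ; [exact: cliff_star_subalgebra|exact: cliff1].
have st' : {subset s <= t} by move=> k ks; apply: st; rewrite inE ks orbT.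
move=> [u [v [/(IH _ st') hu /(IH _ st') hv ->]]].
by apply: cliffD => //; apply: cliffM => //; apply: cliff_gen; apply: st; rewrite inE eqxx.
Qed.

                                                                       
                                                               
(** Each other generator anticommutes with both [e i] and [e j], so the two signs cancel.
    Conjugation by [e j * e i] with a spare index [j] is thus an inner automorphism that negates
    [e i] and fixes the generators of [s]. *)
Lemma flip_comm i j s x : i \notin s -> j \notin s -> cliff s x ->
  e j * e i * x = x * (e j * e i).
Proof.
elim: s x => [|k s IH] x.
  by move=> _ _ [c ->]; rewrite -scalerAr mulr1 -scalerAl mul1r.
rewrite !inE !negb_or => /andP[ik ins] /andP[jk jns] [u [v [hu hv ->]]].
rewrite mulrDr mulrDl; congr (_ + _); first exact: IH.
rewrite mulrA (IH v) // -!mulrA; congr (_ * _).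
by rewrite (e_anti ik) mulrN [e j * (_ * _)]mulrA (e_anti jk) mulNr opprK mulrA.
Qed.

Lemma flip_sq i j : e j * e i * (e i * e j) = 1.
Proof. by rewrite -mulrA [e i * _]mulrA e_sq mul1r e_sq. Qed.

Lemma flip_gen i j : i != j -> e j * e i * e i * (e i * e j) = - e i.
Proof.
by move=> ij; rewrite -[e j * _ * _]mulrA e_sq mulr1 mulrA (e_anti (i := j)) 1?eq_sym //
  mulNr -mulrA e_sq mulr1.
Qed.

Lemma flip_cliff i j s y z : i != j -> i \notin s -> j \notin s ->
  cliff s y -> cliff s z ->
  e j * e i * (y + z * e i) * (e i * e j) = y - z * e i.
Proof.
move=> ij ins jns hy hz; rewrite mulrDr mulrDl (flip_comm ins jns hy).
rewrite -mulrA flip_sq mulr1; congr (_ + _).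
rewrite [e j * e i * (z * _)]mulrA (flip_comm ins jns hz) -mulrN -(flip_gen ij).
by rewrite !mulrA.
Qed.

(** Averaging over the flip of [e i] is a continuous projection of y + z e_i onto y. A limit
    therefore splits into limits of its two components, and induction applies to each. *)
Lemma cliff_norm_closed s : uniq s -> norm_closed (cliff s).
Proof.
elim: s => [|i s IH] /=; first by move=> _; exact: scalars_norm_closed.
move=> /andP[ins us] w x hw wx.
have [j] := e_fresh (i :: s); rewrite inE negb_or => /andP[ji jns].
have ij : i != j by rewrite eq_sym.
have /choice[u /choice[v uv]] : forall n, exists u v,
    [/\ cliff s u, cliff s v & w n = u + v * e i] by move=> n; exact: hw.
pose P z := ((2 : R[i])^-1 *: 1 : T) * (z + e j * e i * z * (e i * e j)).
have Pw n : P (w n) = u n.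
  have [hu hv ->] := uv n.
  rewrite /P (flip_cliff ij ins jns hu hv) addrACA subrr addr0 -scalerAl mul1r -mulr2n.
  by rewrite -[u n *+ 2]scaler_nat scalerA mulVf ?scale1r // pnatr_eq0.
have uP : cvto u (P x).
  rewrite (_ : u = P \o w); last by apply/funext => n /=; rewrite Pw.
  by apply: cvtoMl; apply: cvtoD => //; apply: cvtoMr; apply: cvtoMl.
have vP : cvto v ((x + (- 1) * P x) * e i).
  rewrite (_ : v = fun n => (w n + (-1) * u n) * e i); last first.
    apply/funext => n; have [_ _ ->] := uv n.
    by rewrite mulN1r addrAC subrr add0r -mulrA e_sq mulr1.
  by apply: cvtoMr; apply: cvtoD => //; apply: cvtoMl.
exists (P x), ((x + (- 1) * P x) * e i); split.
- by apply: (IH us _ _ _ uP) => n; case: (uv n).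
- by apply: (IH us _ _ _ vP) => n; case: (uv n).
- by rewrite -mulrA e_sq mulr1 mulN1r addrC subrK.
Qed.

Lemma cliff_cstar s : uniq s -> cstar_subalgebra (cliff s).
Proof.
by move=> us; have [? ? ? ?] := cliff_star_subalgebra us; split=> //; exact: cliff_norm_closed.
Qed.

Lemma cliff_findim s : findim (cliff s).
Proof.
elim: s => [|i s [n [v hv]]].
  by exists 1%N, (fun=> 1) => x [c ->]; exists (fun=> c); rewrite big_ord1.
exists (n + n)%N, (fun q => match fintype.split q with inl a => v a | inr b => v b * e i end).
move=> x [y [z [/hv[a ->] /hv[b ->] ->]]].
exists (fun q => match fintype.split q with inl p => a p | inr p => b p end).
rewrite big_split_ord /= mulr_suml; congr (_ + _); apply: eq_bigr => k _.
  case: splitP => l /= kl; first by rewrite (_ : l = k) //; apply: val_inj.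
  by have := ltn_ord k; rewrite kl ltnNge leq_addr.
case: splitP => l /= kl; first by have := ltn_ord l; rewrite -kl ltnNge leq_addr.
by rewrite (_ : l = k) ?scalerAl //; apply/val_inj/eqP; rewrite -(eqn_add2l n) kl.
Qed.

Section Trace.
Variable tau : T -> R[i].
Hypothesis tauS : state_on [set: T] tau.
Hypothesis tauC : forall x y, tau (x * y) = tau (y * x).

(** The flip of [e i] is inner, hence preserves the trace, and it negates [x * e i]. *)
Lemma tau_gen i s x : i \notin s -> cliff s x -> tau (x * e i) = 0.
Proof.
move=> ins hx; have [j] := e_fresh (i :: s); rewrite inE negb_or => /andP[ji jns].
have ij : i != j by rewrite eq_sym.
have h : tau (x * e i) = - tau (x * e i).
  rewrite -(tauN tauS) -[- _](add0r) -(flip_cliff ij ins jns (cliff0 s) hx) add0r.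
  by rewrite [RHS]tauC !mulrA -[_ * e j * e j]mulrA e_sq mulr1 e_sq mul1r.
apply/eqP; have : tau (x * e i) *+ 2 == 0 by rewrite mulr2n {1}h addNr.
by rewrite mulrn_eq0.
Qed.

(** By [tau_gen] the components of u + v e_i are orthogonal, so the squared norm is the sum of those
    of [u] and [v]. *)
Lemma cliff_faithful s : uniq s -> faithful_on (cliff s) tau.
Proof.
elim: s => [|i s IH] /=.
  move=> _ x [c ->]; rewrite starZ star1 -scalerAl mul1r scalerA (tauZ tauS) (tau1 tauS) mulr1.
  by move/eqP; rewrite mulf_eq0 conjC_eq0 orbb => /eqP ->; rewrite scale0r.
move=> /andP[ins us] x [u [v [hu hv ->]]].
have d1 : tau (star u * v * e i) = 0.
  by apply: (tau_gen ins); apply: cliffM => //; exact: cliff_star.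
have d2 : tau (e i * star v * u) = 0.
  rewrite -mulrA tauC; apply: (tau_gen ins).
  by apply: cliffM => //; exact: cliff_star.
rewrite raddfD /= starM e_star mulrDl !mulrDr !(tauD tauS) mulrA d1 d2 addr0 add0r.
rewrite [tau (e i * _ * _)]tauC !mulrA -[_ * e i * e i]mulrA e_sq mulr1 [tau (v * _)]tauC.
have := tau_ge0 tauS u; have := tau_ge0 tauS v => v0 u0 /eqP.
by rewrite paddr_eq0 // => /andP[/eqP/(IH us _ hu) -> /eqP/(IH us _ hv) ->]; rewrite mul0r addr0.
Qed.

Lemma cliff_fdalg s : uniq s -> fdalg tau (cliff s).
Proof.
move=> us; split; [exact: cliff_star_subalgebra|exact: cliff_findim|].
exact: cliff_faithful.
Qed.

                                                                        
                                                 
(** The commuting square: the terms of [y] that contain a generator from [t] are orthogonal to all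
    of [cliff r], so only the part over [s] survives, although [r] may be larger than [s]. *)
Lemma cliff_expectation t s (r : seq I) y : uniq (t ++ r) -> {subset s <= r} -> cliff (t ++ s) y ->
  exists2 y0, cliff s y0 & forall d, cliff r d -> tau (y * d) = tau (y0 * d).
Proof.
elim: t y => [|i t IH] y /=; first by move=> _ _ hy; exists y.
rewrite mem_cat negb_or => /andP[/andP[it ir] utr] sr [u [v [hu hv ->]]].
have [y0 hy0 y0E] := IH u utr sr hu; exists y0 => // d hd.
rewrite mulrDl (tauD tauS) y0E // [X in _ + X](_ : _ = 0) ?addr0 //.
rewrite tauC mulrA; apply: (tau_gen (s := t ++ r)).
  by rewrite mem_cat negb_or it.
apply: cliffM => //.
  by apply: cliff_mono hd => // k kr; rewrite mem_cat kr orbT.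
by apply: cliff_mono hv => // k; rewrite !mem_cat => /orP[-> //|/sr ->]; rewrite orbT.
Qed.

End Trace.

(** The flip of [e i] sends u + v e_i to u - v e_i, so invariance forces v = 0 and removes one
    generator of [t] at a time. *)
Lemma cliff_flip_fixed (r : seq I) t s y : uniq (t ++ s) -> {subset t ++ s <= r} ->
  (forall i j, i \in t -> j \notin r -> e j * e i * y * (e i * e j) = y) ->
  cliff (t ++ s) y -> cliff s y.
Proof.
elim: t y => [//|i t IH] y /= /andP[its uts] tr fy [u [v [hu hv yE]]].
have [j jr] := e_fresh r.
have := fy i j; rewrite inE eqxx => /(_ isT jr).
have /andP[ji jts] : (j != i) && (j \notin t ++ s).
  by rewrite -negb_or -in_cons; apply: contra jr; exact: tr.
rewrite {1}yE (flip_cliff _ its jts hu hv) 1?eq_sym // yE => /addrI/eqP.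
rewrite eq_sym -subr_eq0 opprK -mulr2n -[_ *+ 2]scaler_nat scaler_eq0 pnatr_eq0 /= => /eqP v0.
have yu : y = u by rewrite yE v0 addr0.
rewrite -yE yu; apply: IH => // [k kts|k l kt lr].
  by apply: tr; rewrite inE kts orbT.
by rewrite -yu fy // inE kt orbT.
Qed.

End Clifford.

Section Majorana.
Variables (R : realType) (T : cstarAlgType R) (a : int -> T).
Hypothesis aa : forall i j, a i * a j + a j * a i = 0.
Hypothesis aas : forall i j, a i * star (a j) + star (a j) * a i = (i == j)%:R.

Let acm (x y : T) := x * y + y * x.

Let acmD x y z : acm (x + y) z = acm x z + acm y z.
Proof. by rewrite /acm mulrDl mulrDr addrACA. Qed.
Let acmDr x y z : acm x (y + z) = acm x y + acm x z.
Proof. by rewrite /acm mulrDl mulrDr addrACA. Qed.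
Let acmN x y : acm (- x) y = - acm x y.
Proof. by rewrite /acm mulNr mulrN opprD. Qed.
Let acmNr x y : acm x (- y) = - acm x y.
Proof. by rewrite /acm mulNr mulrN opprD. Qed.
Let acmZ c x y : acm (c *: x) y = c *: acm x y.
Proof. by rewrite /acm -scalerAl -scalerAr scalerDr. Qed.
Let acmZr c x y : acm x (c *: y) = c *: acm x y.
Proof. by rewrite /acm -scalerAl -scalerAr scalerDr. Qed.

Let ass i j : acm (star (a i)) (star (a j)) = 0.
Proof. by rewrite /acm -!starM -raddfD /= aa raddf0. Qed.
Let asa i j : acm (star (a i)) (a j) = (i == j)%:R.
Proof. by rewrite /acm addrC aas eq_sym. Qed.

(** The Majorana operators: each mode yields two self-adjoint unitaries, and distinct ones
    anticommute. *)
Definition majorana (p : int * bool) : T :=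
  if p.2 then 'i *: (a p.1 - star (a p.1)) else a p.1 + star (a p.1).

Lemma majorana_star p : star (majorana p) = majorana p.
Proof.
rewrite /majorana; case: p => i [] /=; last by rewrite raddfD /= starK addrC.
by rewrite starZ conjCi raddfB /= starK scaleNr -scalerN opprB.
Qed.

Let majorana_acm p q : acm (majorana p) (majorana q) = (p == q)%:R *+ 2.
Proof.
have ii : 'i * 'i = -1 :> R[i] by rewrite -expr2 sqrCi.
case: p q => [i s] [j t]; rewrite xpair_eqE /majorana.
case: s t => [] [] /=; rewrite ?acmZ ?acmZr !acmD !acmDr ?acmN ?acmNr ?[acm (a i) (a j)]aa
  ?[acm (a i) (star (a j))]aas ?ass ?asa ?andbT ?andbF ?addr0 ?add0r ?sub0r ?opprK.
- by rewrite scalerA ii scaleN1r addr0 -opprD opprK -mulr2n.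
- by rewrite subr0 subrr scaler0 mul0rn.
- by rewrite subr0 addNr scaler0 mul0rn.
- by rewrite -mulr2n.
Qed.

Lemma majorana_sq p : majorana p * majorana p = 1.
Proof.
have := majorana_acm p p; rewrite eqxx /acm -mulr2n => /eqP.
rewrite -subr_eq0 -mulrnBl -scaler_nat scaler_eq0 pnatr_eq0 /= subr_eq0.
by move/eqP.
Qed.

Lemma majorana_anti p q : p != q -> majorana p * majorana q = - (majorana q * majorana p).
Proof.
move=> pq; have := majorana_acm p q; rewrite (negPf pq) mul0rn /acm => /eqP.
by rewrite addr_eq0 => /eqP.
Qed.

Lemma majorana_fresh (s : seq (int * bool)) : exists j, j \notin s.
Proof.
(* A mode beyond all those listed; the lattice is infinite, so spare indices for flips always
   exist. *)
pose m := (\max_(p <- s) `|p.1|%N).+1.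
exists (m%:Z, true); apply/negP => h.
have := @leq_bigmax_seq _ s xpredT (fun p => `|p.1|%N) _ h isT.
by rewrite /= ltnn.
Qed.

(** The algebraic span is already norm closed, so generating a C*-algebra adds nothing; each a_i is
    recovered as half the sum of its first Majorana operator and -i times the second. *)
Lemma car_localE (I : set int) (s : seq (int * bool)) :
  uniq s -> (forall p, p \in s <-> I p.1) -> car_local a I = cliff majorana s.
Proof.
move=> us sI; rewrite /car_local /cstar_generated; apply/seteqP; split => x /=.
  apply; first exact: (cliff_cstar majorana_star majorana_sq majorana_anti majorana_fresh us).
  move=> _ [i Ii <-].
  have -> : a i = (2 : R[i])^-1 *: (majorana (i, false) + (- 'i) *: majorana (i, true)).
    rewrite /majorana /= scalerA mulNr -expr2 sqrCi opprK scale1r addrACA subrr addr0 -mulr2n.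
    by rewrite -[a i *+ 2]scaler_nat scalerA mulVf ?scale1r // pnatr_eq0.
  have hs := cliff_star_subalgebra majorana_star majorana_sq majorana_anti us.
  apply: salgZ => //; rewrite addrC; apply: salgP => //; apply: cliff_gen; exact/sI.
move=> hx D hD aD; have hs : star_subalgebra D by case: hD.
have : forall p, p \in s -> D (majorana p).
  move=> [i b] /sI /= Ii; have ai : D (a i) by apply: aD; exists i.
  have asi : D (star (a i)) by apply: salg_star.
  by rewrite /majorana /=; case: b; [apply: salgZ => //; apply: salgB|apply: salgD].
elim: (s) x hx => [|p t IH] x /=; first by move=> [c ->] _; apply: salgZ => //; exact: salg1.
move=> [u [v [hu hv ->]]] h.
have h' q : q \in t -> D (majorana q) by move=> qt; apply: h; rewrite inE qt orbT.
apply: salgD => //; first exact: IH.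
by apply: salgM => //; [exact: IH|apply: h; rewrite inE eqxx].
Qed.

End Majorana.

Definition modes (s : seq int) : seq (int * bool) := [seq (i, b) | i <- s, b <- [:: false; true]].

Lemma mem_modes s p : (p \in modes s) = (p.1 \in s).
Proof.
apply/allpairsP/idP => [[q [qs _ ->]] //|ps]; exists p; split=> //; last by case: p ps.
by rewrite !inE; case: (p.2).
Qed.

Lemma modes_uniq s : uniq s -> uniq (modes s).
Proof. by move=> us; apply: allpairs_uniq => // -[? ?] [? ?] _ _. Qed.

Lemma finite_modes (A : set int) : finite_set A ->
  exists2 s, uniq s & forall p, p \in modes s <-> A p.1.
Proof.
move=> /finite_seqP[s ->]; exists (undup s); first exact: undup_uniq.
by move=> p; rewrite mem_modes mem_undup.
Qed.

                           

(** * Real combinations of logarithms and resolvents *)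

Section Resolvents.
Variable R : realType.
Implicit Types (r : seq (R * R)) (ts : seq R) (s t u : R).

Section Logarithms.
Variables (J : finType) (c t : J -> R).
Hypothesis t0 : forall i, 0 < t i.

Let G s : R := \sum_i c i * ln (s + t i).
Let F s : R := \sum_i c i / (s + t i).

Let G_derive s : 0 <= s -> is_derive s 1 G (F s).
Proof.
move=> s0; rewrite /G /F.
elim: (index_enum J) => [|i l IH].
  by under eq_fun do rewrite big_nil; rewrite big_nil; exact: is_derive_cst.
under eq_fun do rewrite big_cons; rewrite big_cons.
suff h : is_derive s 1 (fun s => c i * ln (s + t i)) (c i / (s + t i)).
  exact: is_deriveD.
have st : 0 < s + t i by rewrite ltr_wpDl.
have h1 : is_derive s 1 (fun s => s + t i) 1.
  by rewrite -[X in is_derive _ _ _ X]addr0; apply: is_deriveD.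
have h2 := is_derive1_ln st.
have h3 := @is_derive1_comp _ (@ln R) (fun s => s + t i) s _ _ h2 h1.
by have := is_deriveZ (c i) h3; rewrite mulr1; exact.
Qed.

(** The resolvent sum [F] is the derivative of [G]. So [G] is nondecreasing, starts at 0, and has an
    upper bound tending to 0 at infinity; it vanishes, and so does its derivative. *)
Lemma resolvent_eq0 : \sum_i c i = 0 -> \sum_i c i * ln (t i) = 0 ->
  (forall s, 0 < s -> 0 <= \sum_i c i / (s + t i)) ->
  forall s, 0 < s -> \sum_i c i / (s + t i) = 0.
Proof.
move=> c0 cln F0.
have dG s : 0 <= s -> derivable G s 1 by move=> /G_derive [].
have GdE s : 0 <= s -> G^`()%classic s = F s by move=> /G_derive h; rewrite derive1E derive_val.
have incr s u : 0 <= s -> s <= u -> G s <= G u.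
  move=> s0 su; apply: (@ger0_derive1_ndecry _ G 0) => //.
  - by move=> v; rewrite in_itv /= andbT => v0; apply/dG/ltW.
  - by move=> v; rewrite in_itv /= andbT => v0; rewrite GdE ?F0 // ltW.
  - by apply: derivable_within_continuous => v; rewrite in_itv /= andbT => v0; exact: dG.
have G0 : G 0 = 0 by rewrite /G -[RHS]cln; apply: eq_bigr => i _; rewrite add0r.
pose K := \sum_i `|c i| * t i.
(* As the weights sum to 0, ln s may be subtracted from every term; then ln (1 + z) <= z. *)
have GK s : 0 < s -> G s <= K / s.
  move=> s0; have -> : G s = \sum_i c i * ln (1 + t i / s).
    have -> : G s = \sum_i c i * ln s + \sum_i c i * ln (1 + t i / s).
      rewrite -big_split; apply: eq_bigr => i _ /=; rewrite -mulrDr -lnM ?posrE //.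
        by rewrite mulrDr mulr1 mulrCA divff ?mulr1 // gt_eqF.
      by rewrite ltr_wpDr // divr_ge0 // ltW.
    by rewrite -mulr_suml c0 mul0r add0r.
  rewrite /K mulr_suml; apply: ler_sum => i _.
  have ts0 : 0 <= t i / s by rewrite divr_ge0 // ltW.
  have l0 : 0 <= ln (1 + t i / s) by rewrite ln_ge0 // lerDl.
  apply: le_trans (ler_wpM2r l0 (ler_norm _)) _.
  rewrite -mulrA; apply: ler_wpM2l => //.
  by have := @le_ln1Dx _ (t i / s); apply; lra.
have Gz s : 0 <= s -> G s = 0.
  move=> s0; apply/eqP; rewrite eq_le -{2}G0 incr // andbT.
  apply/ler_addgt0Pl => e e0; rewrite addr0.
  have K0 : 0 <= K by apply: sumr_ge0 => i _; rewrite mulr_ge0 // ltW.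
  pose u := s + 1 + K / e.
  have Ke : 0 <= K / e by rewrite divr_ge0 // ltW.
  have u0 : 0 < u by rewrite /u; lra.
  apply: le_trans (incr s u s0 _) _; first by rewrite /u; lra.
  apply: le_trans (GK u u0) _; rewrite ler_pdivrMr // /u !mulrDr mulrCA divff ?gt_eqF //.
  by nra.
move=> s s0; rewrite -/(F s) -GdE; last exact: ltW.
rewrite derive1E (@near_eq_derive _ _ _ _ (cst 0)) ?derive_cst // ?oner_eq0 //.
near=> v; apply: Gz; apply/ltW; near: v; exact: lt_nbhsr.
Unshelve. all: by end_near.
Qed.

End Logarithms.

Definition resolvents r t : R := \sum_(p <- r) p.1 / (p.2 + t).

(** A combination whose positive zeros are exactly [ts], playing the role of the nodal polynomial in
    Newton interpolation. A new zero [u] is created by the factor (t - u) / (M + t). *)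
Lemma resolvents_vanishing ts : (forall t, t \in ts -> 0 < t) ->
  exists r, (forall p, p \in r -> 0 < p.2) /\
    forall t, 0 < t -> (resolvents r t == 0) = (t \in ts).
Proof.
elim: ts => [_|u ts IH ts0].
  exists [:: (1, 1)]; split=> [p|t t0]; first by rewrite inE => /eqP ->.
  by rewrite /resolvents big_seq1 /= div1r invr_eq0 gt_eqF // addr_gt0.
have u0 : 0 < u by apply: ts0; rewrite inE eqxx.
have [|r [r0 rE]] := IH; first by move=> t tts; apply: ts0; rewrite inE tts orbT.
(* The new pole exceeds the old ones, so partial fractions keep all poles simple; the lists given
   below are the resulting coefficients. *)
pose M := \sum_(p <- r) p.2 + 1.
have rM p : p \in r -> p.2 < M.
  move=> pr; rewrite /M (big_rem p pr) /= -addrA ltrDl ltr_wpDl // big_seq.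
  by apply: sumr_ge0 => q /mem_rem /r0 /ltW.
have M0 : 0 < M by rewrite /M ltr_wpDl // big_seq; apply: sumr_ge0 => q /r0 /ltW.
exists ([seq (p.1 * ((p.2 + u) / (p.2 - M)), p.2) | p <- r] ++
        [seq (p.1 * ((M + u) / (M - p.2)), M) | p <- r]); split=> [p|t t0].
  by rewrite mem_cat => /orP[] /mapP[q qr ->] //=; apply: r0.
rewrite /resolvents big_cat !big_map /= -big_split /=.
rewrite (_ : \sum_(_ <- _) _ = (t - u) / (M + t) * resolvents r t).
  rewrite mulf_eq0 rE // inE mulf_eq0 invr_eq0 subr_eq0.
  by rewrite [M + t == 0]gt_eqF ?orbF // addr_gt0.
rewrite /resolvents mulr_sumr big_seq [RHS]big_seq; apply: eq_bigr => -[b v] pr /=.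
have /= vM := rM _ pr; have /= v0 := r0 _ pr; field.
apply/and4P; split; first by rewrite gt_eqF // addr_gt0.
- by rewrite gt_eqF // addr_gt0.
- by rewrite gt_eqF // subr_gt0.
- by rewrite lt_eqF // subr_lt0.
Qed.

Lemma resolvents_interpolation (f : R -> R) ts : (forall t, t \in ts -> 0 < t) ->
  exists r, (forall p, p \in r -> 0 < p.2) /\ forall t, t \in ts -> f t = resolvents r t.
Proof.
elim: ts => [_|u ts IH ts0]; first by exists [::].
have u0 : 0 < u by apply: ts0; rewrite inE eqxx.
have ts0' t : t \in ts -> 0 < t by move=> tts; apply: ts0; rewrite inE tts orbT.
have [r [r0 rE]] := IH ts0'.
have [uts|uts] := boolP (u \in ts).
  by exists r; split=> // t; rewrite inE => /orP[/eqP ->|]; exact: rE.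
have [r' [r'0 r'E]] := resolvents_vanishing ts0'.
pose k := (f u - resolvents r u) / resolvents r' u.
exists (r ++ [seq (k * p.1, p.2) | p <- r']); split=> [p|t].
  by rewrite mem_cat => /orP[/r0 //|/mapP[q /r'0 q0 ->]].
have -> : resolvents (r ++ [seq (k * p.1, p.2) | p <- r']) t =
    resolvents r t + k * resolvents r' t.
  rewrite /resolvents big_cat big_map mulr_sumr /=; congr (_ + _).
  by apply: eq_bigr => p _; rewrite mulrA.
rewrite inE => /orP[/eqP ->|tts].
  by rewrite /k divfK ?r'E // addrC subrK.
have /eqP -> : resolvents r' t == 0 by rewrite r'E // ts0'.
by rewrite mulr0 addr0 rE.
Qed.

(** On the finite set of values of [t] every function is a combination of resolvents. *)
Lemma resolvents_determine (V : lmodType R[i]) (J : finType) (t : J -> R) (z : J -> V) :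
  (forall i, 0 < t i) ->
  (forall s, 0 < s -> \sum_i ((s + t i)^-1)%:C%C *: z i = 0) ->
  forall f : R -> R, \sum_i (f (t i))%:C%C *: z i = 0.
Proof.
move=> t0 h f; have [|r [r0 rE]] := @resolvents_interpolation f (codom t).
  by move=> _ /codomP[i ->].
under eq_bigr => i _.
  rewrite rE ?codom_f // /resolvents rmorph_sum /= scaler_suml.
  under eq_bigr do rewrite rmorphM -scalerA.
  over.
rewrite exchange_big big_seq big1 //= => p pr.
by rewrite -scaler_sumr h ?scaler0 // r0.
Qed.

End Resolvents.

                                       

(** * The relative modular operator *)

Section RelativeModularOperator.
Variables (R : realType) (T : cstarAlgType R).
Variables (J K : finType) (sigma rho : T) (m : J -> R) (q : J -> T) (l : K -> R) (p : K -> T).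
Hypothesis rs : resolution sigma m q.
Hypothesis rr : resolution rho l p.
Hypothesis m0 : forall j, 0 < m j.
Hypothesis l0 : forall k, 0 < l k.

                                                                                
(** This is f(Delta) applied to 1, where Delta sends X to sigma X rho^-1. Left and right
    multiplications commute, so Delta is diagonal with eigenvalues m_j / l_k even if [sigma] and
    [rho] do not commute. *)
Definition modcalc (f : R -> R) : T :=
  \sum_(i : J * K) (f (m i.1 / l i.2))%:C%C *: (q i.1 * p i.2).

Lemma modcalc_split (f : R -> R) (g : J -> R) (h : K -> R) :
  (forall j k, f (m j / l k) = g j * h k) ->
  modcalc f = (\sum_j (g j)%:C%C *: q j) * (\sum_k (h k)%:C%C *: p k).
Proof.
move=> fE; rewrite mulr_suml /modcalc.
rewrite -(pair_bigA _ (fun j k => (f (m j / l k))%:C%C *: (q j * p k))).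
apply: eq_bigr => j _; rewrite mulr_sumr; apply: eq_bigr => k _ /=.
by rewrite fE rmorphM -scalerAl -scalerAr scalerA.
Qed.

Lemma modcalc_cst : modcalc (fun=> 1) = 1.
Proof.
have [_ _ q1 _] := rs; have [_ _ p1 _] := rr.
rewrite (@modcalc_split _ (fun=> 1) (fun=> 1)); last by move=> *; rewrite mulr1.
by under eq_bigr do rewrite scale1r; rewrite q1 mul1r; under eq_bigr do rewrite scale1r.
Qed.

Lemma modcalc_ln : modcalc (@ln R) = funcalc (@ln R) sigma - funcalc (@ln R) rho.
Proof.
have [_ _ q1 _] := rs; have [_ _ p1 _] := rr.
rewrite (funcalcE _ rs) (funcalcE _ rr) /calc -[X in X - _]mulr1 -p1 -[X in _ - X]mul1r -q1.
rewrite !mulr_suml -sumrB /modcalc.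
rewrite -(pair_bigA _ (fun j k => (ln (m j / l k))%:C%C *: (q j * p k))).
apply: eq_bigr => j _; rewrite !mulr_sumr -sumrB; apply: eq_bigr => k _ /=.
by rewrite ln_div ?posrE // rmorphB scalerBl -scalerAl -scalerAr.
Qed.

Lemma modcalc_pwr (n : int) :
  modcalc (fun t => t ^ n) = pwr sigma n * pwr rho (- n).
Proof.
rewrite /pwr (funcalcE _ rs) (funcalcE _ rr).
apply: (@modcalc_split _ (fun j => m j ^ n) (fun k => l k ^ - n)) => j k.
by rewrite expfzMl exprz_inv.
Qed.

Lemma modcalc_in D f : star_subalgebra D -> (forall j, D (q j)) -> (forall k, D (p k)) ->
  D (modcalc f).
Proof.
by move=> hD qD pD; apply: salg_sum => // i _; apply: salgZ => //; apply: salgM.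
Qed.

(** The equation (s + Delta) X = 1, multiplied by [rho] on the right to clear the inverse. *)
Lemma modcalc_resolvent s : 0 < s ->
  let X := modcalc (fun t => (s + t)^-1) in sigma * X + s%:C%C *: (X * rho) = rho.
Proof.
move=> s0 X; rewrite mulr_sumr mulr_suml scaler_sumr -big_split /=.
have [_ _ q1 _] := rs; have [_ _ _ rhoE] := rr.
transitivity (\sum_(i : J * K) (l i.2)%:C%C *: (q i.1 * p i.2)).
  apply: eq_bigr => -[j k] _ /=.
  rewrite -scalerAr -scalerAl mulrA (resolution_mul _ rs) -[q j * p k * _]mulrA.
  rewrite (resolution_mulr _ rr) -scalerAr -scalerAl !scalerA -scalerDl -!rmorphM -rmorphD.
  congr (_%:C%C *: _); field.
  by rewrite gt_eqF //= gt_eqF // addr_gt0 // mulr_gt0.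
rewrite -(pair_bigA _ (fun j k => (l k)%:C%C *: (q j * p k))) exchange_big /= [RHS]rhoE.
by apply: eq_bigr => k _; rewrite -scaler_sumr -mulr_suml q1 mul1r.
Qed.

Section Trace.
Variable tau : T -> R[i].
Hypothesis tauT : tracial_state tau.
Let tauS := tauT.1.
Let tauC := tauT.2.

Definition modweight (i : J * K) : R := l i.2 * complex.Re (tau (q i.1 * p i.2)).

(** The weights form the spectral measure of Delta at the vector rho^(1/2); they are real because
    [tau (q j * p k)] is the squared norm of [q j * p k]. *)
Lemma tau_modcalc f :
  tau (modcalc f * rho) = (\sum_i modweight i * f (m i.1 / l i.2))%:C%C.
Proof.
have [qs qq _ _] := rs; have [ps pp _ _] := rr.
rewrite mulr_suml (tau_sum tauS) rmorph_sum; apply: eq_bigr => -[j k] _ /=.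
rewrite -scalerAl -mulrA (resolution_mulr _ rr) -scalerAr !(tauZ tauS).
have pos : 0 <= tau (q j * p k).
  have := tau_ge0 tauS (q j * p k).
  by rewrite starM ps qs -mulrA tauC !mulrA qq eqxx -mulrA pp eqxx.
have -> : tau (q j * p k) = (complex.Re (tau (q j * p k)))%:C%C.
  by rewrite RRe_real // ger0_real.
by rewrite /modweight /= -!rmorphM; congr (_%:C%C); ring.
Qed.

End Trace.
End RelativeModularOperator.

(** * Equality in monotonicity of relative entropy *)

Section Sufficiency.
Variables (R : realType) (T : cstarAlgType R) (tau : T -> R[i]).
Hypothesis tauT : tracial_state tau.
Let tauS := tauT.1.
Let tauC := tauT.2.
Variables (D E : set T).
Hypothesis hD : fdalg tau D.
Hypothesis hE : fdalg tau E.
Hypothesis ED : E `<=` D.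
Variables rho sigma r b : T.
Hypothesis hrho : spd D rho.
Hypothesis hsigma : spd D sigma.
Hypothesis hr : spd E r.
Hypothesis hb : spd E b.
Hypothesis rE : forall d, E d -> tau (rho * d) = tau (r * d).
Hypothesis bE : forall d, E d -> tau (sigma * d) = tau (b * d).

(** The quadratic form of s + Delta for the inner product [tau (star Y * Z * rho)]. *)
Let Q s Z := tau (star Z * (sigma * Z + s%:C%C *: (Z * rho))).

Let QE s Z : Q s Z = tau (star Z * sigma * Z) + s%:C%C * tau (star Z * Z * rho).
Proof. by rewrite /Q mulrDr (tauD tauS) -scalerAr (tauZ tauS) !mulrA. Qed.

Let rho_ge0 Z : 0 <= tau (star Z * Z * rho).
Proof.
have [z [hz -> _]] := spd_sqrt hrho.
have := tau_ge0 tauS (Z * z); rewrite starM (spd_sa hz).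
by rewrite -!mulrA tauC -!mulrA.
Qed.

Let Q_ge0 s Z : 0 < s -> 0 <= Q s Z.
Proof.
move=> s0; rewrite QE; apply: addr_ge0; last by rewrite mulr_ge0 // ler0c ltW.
have [z [hz -> _]] := spd_sqrt hsigma; have := tau_ge0 tauS (z * Z).
by rewrite starM (spd_sa hz) !mulrA.
Qed.

Let Q_eq0 s Z : 0 < s -> D Z -> Q s Z = 0 -> Z = 0.
Proof.
move=> s0 dZ; have [-> //|Z0] := eqVneq Z 0.
have := spd_gt0 tauS hD hsigma (@subset_refl _ D) dZ Z0.
rewrite QE => h e; have : 0 < Q s Z by rewrite QE ltr_pwDl // mulr_ge0 // ler0c ltW.
by rewrite QE e ltxx.
Qed.

                                                                             
                                     
(** [X] and [X0] solve the resolvent equations on the large and the small algebra. On [E] the form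
    [Q] depends only on the marginals [b] and [r], so [X0] is the projection of [X] to [E] for this
    form, and the identity is Pythagoras. *)
Let gap s X X0 : E X0 ->
  sigma * X + s%:C%C *: (X * rho) = rho -> b * X0 + s%:C%C *: (X0 * r) = r ->
  Q s (X - X0) = (tau (X * rho))^* - tau (X0 * r).
Proof.
move=> eX0 XE X0E; have [hE' _ _] := hE.
rewrite /Q raddfB /= (mulrBr sigma) [(X - X0) * rho]mulrBl scalerBr addrACA -opprD XE.
rewrite mulrBl !mulrBr !(tauB tauS).
set Y := sigma * X0 + _.
(* Z -> sigma Z + s Z rho is symmetric for the trace, so it can be moved onto [X]. *)
have -> : tau (star X * Y) = (tau (star X0 * rho))^*.
  rewrite -(tau_star tauS) starM starK (spd_sa hrho).
  have XE' : rho = star X * sigma + s%:C%C *: (rho * star X).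
    by rewrite -{1}(spd_sa hrho) -{1}XE raddfD /= starZr !starM (spd_sa hsigma) (spd_sa hrho).
  rewrite [in RHS]XE' /Y mulrDl mulrDr !(tauD tauS) -scalerAl -scalerAr !(tauZ tauS) !mulrA.
  by congr (_ + _ * _); rewrite [LHS]tauC mulrA.
(* Here [sigma] and [rho] are paired only with elements of [E], where they may be exchanged for [b]
   and [r]. *)
have -> : tau (star X0 * Y) = tau (star X0 * rho).
  have d1 : E (X0 * star X0) by apply: salgM => //; apply: salg_star.
  have d2 : E (star X0 * X0) by apply: salgM => //; apply: salg_star.
  have d3 : E (star X0) by apply: salg_star.
  rewrite [RHS]tauC rE // -X0E [RHS]tauC /Y !mulrDr !(tauD tauS) -!scalerAr !(tauZ tauS) !mulrA.
  congr (_ + _ * _).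
    by rewrite -!mulrA tauC [RHS]tauC -!mulrA bE.
  by rewrite tauC [RHS]tauC rE.
rewrite subrr subr0.
have -> : tau (star X * rho) = (tau (X * rho))^*.
  by rewrite -(tau_star tauS) starM (spd_sa hrho) tauC.
suff -> : (tau (star X0 * rho))^* = tau (X0 * r) by [].
by rewrite -(tau_star tauS) starM starK (spd_sa hrho) rE // tauC.
Qed.

(** Both spectra are merged into one family with signed weights. The entropy hypothesis is the
    vanishing of the logarithmic sum, [gap] makes each resolvent sum a nonnegative [Q], and
    [resolvent_eq0] makes it zero. Definiteness of [Q] identifies the resolvents, hence every
    function of the two modular operators. *)
Lemma sufficiency :
  tau (rho * funcalc (@ln R) rho) - tau (rho * funcalc (@ln R) sigma) =
  tau (r * funcalc (@ln R) r) - tau (r * funcalc (@ln R) b) ->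
  forall n : int, pwr sigma n * pwr rho (- n) = pwr b n * pwr r (- n).
Proof.
move=> eqS n; have [hD' _ _] := hD; have [hE' _ _] := hE.
have [n1 [l [p [rr _ pD l0]]]] := hrho; have [n2 [m [q [rs _ qD m0]]]] := hsigma.
have [n3 [l' [p' [rr' _ pE l'0]]]] := hr; have [n4 [m' [q' [rs' _ qE m'0]]]] := hb.
pose J := (('I_n2 * 'I_n1) + ('I_n4 * 'I_n3))%type.
pose t (i : J) := match i with inl i => m i.1 / l i.2 | inr i => m' i.1 / l' i.2 end.
pose c (i : J) := match i with
  | inl i => modweight q l p tau i | inr i => - modweight q' l' p' tau i end.
have t0 i : 0 < t i by case: i => i; rewrite divr_gt0.
have cE (f : R -> R) : (\sum_i c i * f (t i))%:C%C =
    tau (modcalc m q l p f * rho) - tau (modcalc m' q' l' p' f * r).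
  rewrite (tau_modcalc rs rr tauT) (tau_modcalc rs' rr' tauT) -rmorphB big_sumType /=.
  by rewrite -sumrN; under [X in _ = (_ + X)%:C%C]eq_bigr do rewrite -mulNr.
have key s : 0 < s -> (\sum_i c i / (s + t i))%:C%C =
    Q s (modcalc m q l p (fun t => (s + t)^-1) - modcalc m' q' l' p' (fun t => (s + t)^-1)).
  move=> s0; rewrite (cE (fun t => (s + t)^-1)).
  rewrite (gap _ (modcalc_resolvent rs rr m0 l0 s0) (modcalc_resolvent rs' rr' m'0 l'0 s0)).
    by rewrite (tau_modcalc rs rr tauT) conj_rc.
  exact: modcalc_in.
have F0 : forall s, 0 < s -> \sum_i c i / (s + t i) = 0.
  apply: resolvent_eq0 => //.
  - apply: complexI; have := cE (fun=> 1); under eq_bigr do rewrite mulr1.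
    move=> ->; rewrite (modcalc_cst rs rr) (modcalc_cst rs' rr') !mul1r.
    by rewrite -[rho]mulr1 -[r]mulr1 rE ?subrr //; exact: salg1.
  - apply: complexI; rewrite cE (modcalc_ln rs rr) // (modcalc_ln rs' rr') //.
    rewrite !mulrBl !(tauB tauS) ![tau (funcalc _ _ * _)]tauC.
    by rewrite -[X in X - _]opprB eqS opprB subrr.
  - by move=> s s0; rewrite -ler0c key // Q_ge0.
have := @resolvents_determine _ T J t (fun i => match i with
  inl i => q i.1 * p i.2 | inr i => - (q' i.1 * p' i.2) end) t0.
have sumE (f : R -> R) : \sum_i (f (t i))%:C%C *: (match i with
    inl i => q i.1 * p i.2 | inr i => - (q' i.1 * p' i.2) end) =
    modcalc m q l p f - modcalc m' q' l' p' f.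
  rewrite big_sumType /= -sumrN; congr (_ + _).
  by apply: eq_bigr => i _; rewrite scalerN.
move=> h; have {}h f : modcalc m q l p f = modcalc m' q' l' p' f.
  apply/eqP; rewrite -subr_eq0 -sumE h // => s s0.
  rewrite (sumE (fun t => (s + t)^-1)); apply: (Q_eq0 s0).
    by apply: salgB => //; [exact: modcalc_in|apply: ED; exact: modcalc_in].
  by rewrite -key // F0.
by rewrite -(modcalc_pwr rs rr) // -(modcalc_pwr rs' rr').
Qed.

End Sufficiency.

                                     

(** * From the cocycle identities to the factorization *)

Section Factorization.
Variables (R : realType) (T : cstarAlgType R) (tau : T -> R[i]).
Hypothesis tauT : tracial_state tau.
Let tauS := tauT.1.
Let tauC := tauT.2.
Variables (AB BC B : set T).
Hypothesis hAB : fdalg tau AB.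
Hypothesis hBC : fdalg tau BC.
Hypothesis hB : fdalg tau B.
Hypothesis B_AB : B `<=` AB.
Hypothesis B_BC : B `<=` BC.
Let sAB : star_subalgebra AB. Proof. by case: hAB. Qed.
Let sBC : star_subalgebra BC. Proof. by case: hBC. Qed.
Let sB : star_subalgebra B. Proof. by case: hB. Qed.

                                                                          
                                                
(** Pairs of mutually inverse elements commuting with AB and normalizing BC, whose common fixed
    points in BC lie in B. They characterize B inside BC without mention of generators. *)
Variable flip : T -> T -> Prop.
Hypothesis flipK : forall f f', flip f f' -> f * f' = 1 /\ f' * f = 1.
Hypothesis flipC : forall f f', flip f f' -> flip f' f.
Hypothesis flip_AB : forall f f' d, flip f f' -> AB d -> f * d = d * f.
Hypothesis flip_BC : forall f f' d, flip f f' -> BC d -> BC (f * d * f').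
Hypothesis flip_fixed : forall d, BC d -> (forall f f', flip f f' -> f * d * f' = d) -> B d.

Variables rho sigma r b : T.
Variable ABC : set T.
Hypothesis hrho : spd ABC rho.
Hypothesis hsigma : spd AB sigma.
Hypothesis hr : spd BC r.
Hypothesis hb : spd B b.
Hypothesis cocycle : forall n : int, pwr sigma n * pwr rho (- n) = pwr b n * pwr r (- n).

Let w := pwr b (-1) * sigma.

Let rhoE : rho = r * w.
Proof.
have := congr1 (@star R T) (cocycle (-1)); rewrite !starM (star_pwr hsigma) (star_pwr hrho).
rewrite (star_pwr hr) (star_pwr hb) opprK => e.
by rewrite /w mulrA -{1}(pwr1 hr) -e -mulrA (mulVx hsigma) mulr1 (pwr1 hrho).
Qed.

Let v n := pwr b n * pwr r (- n).
Let v' n := pwr r n * pwr b (- n).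

Let vK n : v n * v' n = 1.
Proof. by rewrite /v /v' mulrA -[pwr b n * _ * _]mulrA (pwrKN hr) mulr1 (pwrNK hb). Qed.
Let v'K n : v' n * v n = 1.
Proof. by rewrite /v /v' mulrA -[pwr r n * _ * _]mulrA (pwrKN hb) mulr1 (pwrNK hr). Qed.

(** Multiplying the cocycle by [sigma] on the left shifts the index: w v_n = b^-1 v_(n+1) rho, and
    rho = r w undoes the shift. *)
Let vw n : v n * w = w * v n.
Proof.
have -> : w * v n = pwr b (-1) * v (1 + n) * rho.
  rewrite /v -!cocycle /w opprD [- 1 - n]addrC (pwrD hrho) (pwrD hsigma) (pwr1 hsigma).
  by rewrite -!mulrA (mulVx hrho) mulr1.
rewrite /v opprD [- 1 - n]addrC (pwrD hr) (pwrD hb) (pwr1 hb) rhoE -!mulrA.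
by rewrite [pwr r (-1) * _]mulrA (mulVx hr) mul1r [RHS]mulrA (mulVx hb) mul1r.
Qed.

Let v'w n : v' n * w = w * v' n.
Proof.
rewrite -[LHS]mulr1 -(vK n) mulrA -[v' n * w * v n]mulrA -vw [v' n * (v n * w)]mulrA.
by rewrite v'K mul1r.
Qed.

(** Asking for all conjugates by powers of [b] makes [N] invariant under the modular action x -> b x
    b^-1. *)
Let N : set T := [set x | BC x /\
  forall k, pwr b k * x * pwr b (- k) * w = w * (pwr b k * x * pwr b (- k))].

Let conjM k x y : pwr b k * (x * y) * pwr b (- k) =
  (pwr b k * x * pwr b (- k)) * (pwr b k * y * pwr b (- k)).
Proof. by rewrite !mulrA -[_ * pwr b (- k) * pwr b k]mulrA (pwrKN hb) mulr1. Qed.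

Let conjD j k x : pwr b j * (pwr b k * x * pwr b (- k)) * pwr b (- j) =
  pwr b (j + k) * x * pwr b (- (j + k)).
Proof. by rewrite (pwrD hb) opprD [- j - k]addrC (pwrD hb) !mulrA. Qed.

Let b_AB k : AB (pwr b k). Proof. exact: B_AB (funcalc_in sB hb _). Qed.
Let w_AB : AB w. Proof. exact: (salgM sAB (b_AB _) (spd_in sAB hsigma)). Qed.

Let sN : star_subalgebra N.
Proof.
split=> [|c x y [dx hx] [dy hy]|x y [dx hx] [dy hy]|x [dx hx]].
- by split=> [|k]; [exact: salg1|rewrite mulr1 (pwrNK hb) mul1r mulr1].
- split=> [|k]; first exact: salgP.
  rewrite mulrDr mulrDl -scalerAr -scalerAl.
  by rewrite mulrDl [RHS]mulrDr hy -scalerAl -scalerAr hx.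
- split=> [|k]; first exact: salgM.
  by rewrite conjM; symmetry; exact: (commrM (esym (hx k)) (esym (hy k))).
- split=> [|k]; first exact: salg_star.
  have := congr1 (@star R T) (hx (- (1 + k))).
  (* The adjoint of [w] is itself a conjugate of [w] by [b], so taking adjoints only shifts the
     exponent. *)
  have ws : star w = pwr b 1 * w * pwr b (- 1).
    by rewrite /w starM (spd_sa hsigma) (star_pwr hb) mulrA (pwrNK hb) mul1r.
  have gs : star (pwr b (- (1 + k)) * x * pwr b (- - (1 + k))) =
      pwr b 1 * (pwr b k * star x * pwr b (- k)) * pwr b (- 1).
    by rewrite !starM !(star_pwr hb) opprK conjD mulrA.
  rewrite [LHS]starM [RHS]starM ws gs -!conjM => e.
  have cancel z : z = pwr b (-1) * (pwr b 1 * z * pwr b (-1)) * pwr b (- -1).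
    by rewrite conjD addNr !(pwr0 hb) mulr1 mul1r.
  by rewrite [LHS]cancel [RHS]cancel -e.
Qed.

Let NBC : N `<=` BC. Proof. by move=> x []. Qed.
Let fN : fdalg tau N. Proof. exact: (fdalg_subset hBC sN NBC). Qed.

Let N_modular x : N x -> N (b * x * pwr b (-1)).
Proof.
move=> [dx hx]; split=> [|k].
  apply: salgM => //; last exact: B_BC (funcalc_in sB hb _).
  by apply: salgM => //; apply: B_BC; exact: spd_in hb.
have -> : b * x * pwr b (-1) = pwr b 1 * x * pwr b (-1) by rewrite (pwr1 hb).
by rewrite conjD.
Qed.

Let N_flip f f' x : flip f f' -> N x -> N (f * x * f').
Proof.
move=> ff [dx hx]; split=> [|k]; first exact: flip_BC.
have -> : pwr b k * (f * x * f') * pwr b (- k) = f * (pwr b k * x * pwr b (- k)) * f'.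
  rewrite !mulrA -(flip_AB ff (b_AB k)) -!mulrA.
  by rewrite (flip_AB (flipC ff) (b_AB (- k))).
have fw := esym (flip_AB ff w_AB); have f'w := esym (flip_AB (flipC ff) w_AB).
by symmetry; exact: (commrM (commrM fw (esym (hx k))) f'w).
Qed.

Let u := r * pwr b (-1).

(** The conjugates of r b^-1 by powers of [b] are products of cocycles and inverse cocycles, all
    commuting with [w]. *)
Let Nu : N u.
Proof.
split=> [|k].
  by apply: salgM => //; [exact: spd_in hr|exact: B_BC (funcalc_in sB hb _)].
have -> : pwr b k * u * pwr b (- k) = v k * v' (k + 1).
  rewrite /v /v' mulrA -[pwr b k * pwr r (- k) * _]mulrA -(pwrD hr) addKr (pwr1 hr).
  by rewrite opprD [- k - 1]addrC (pwrD hb) /u !mulrA.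
by symmetry; apply: commrM; symmetry; [exact: vw|exact: v'w].
Qed.

Lemma factorization :
  exists x y, [/\ positive_in AB x, positive_in BC y & rho = x * y].
Proof.
have [h Nh hE] := riesz tauS b fN.
(* The KMS property: on [N] the elements [h] and [b] define the same functional, so they implement
   the same modular automorphism. *)
have hcomm x : N x -> h * x = b * x * pwr b (-1) * h.
  move=> Nx; have Nbx := N_modular Nx.
  apply: (trace_ext tauS fN) => [||z Nz]; [exact: salgM|exact: salgM|].
  have Nxz := salgM sN Nx Nz.
  have -> : tau (b * x * pwr b (-1) * h * z) = tau (h * (z * (b * x * pwr b (-1)))).
    by rewrite -[_ * h * z]mulrA [LHS]tauC -[h * z * _]mulrA.
  rewrite -mulrA !hE; [|exact: salgM|by []].
  have -> : b * (z * (b * x * pwr b (-1))) = b * (z * b * x) * pwr b (-1) by rewrite !mulrA.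
  by rewrite [RHS]tauC [pwr b (-1) * _]mulrA (mulVx hb) mul1r -[z * b * x]mulrA [RHS]tauC !mulrA.
have hs : star h = h.
  apply: (trace_ext tauS fN) => [||z Nz] //; first exact: salg_star.
  have sz := salg_star sN Nz.
  have -> : tau (star h * z) = (tau (star z * h))^* by rewrite -(tau_star tauS) starM starK.
  by rewrite [tau (star z * h)]tauC !hE // -(tau_star tauS) starM starK (spd_sa hb) tauC.
(* Flips preserve [N] and the trace and fix [b], so uniqueness of the density makes [h]
   invariant. *)
have Bh : B h.
  apply: flip_fixed; first exact: NBC.
  move=> f f' ff; have [ff1 f'f1] := flipK ff.
  apply: (trace_ext tauS fN) => [||z Nz] //; first exact: N_flip.
  have cyc y : tau (f * y * f' * z) = tau (y * (f' * z * f)).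
    by rewrite -!mulrA [LHS]tauC -!mulrA.
  rewrite cyc hE; last exact: (N_flip (flipC ff) Nz).
  rewrite -cyc (flip_AB ff); last exact: (B_AB (spd_in sB hb)).
  by rewrite -[b * f * f']mulrA ff1 mulr1 hE.
pose P : set T := [set x | N x /\ B x].
have sP : star_subalgebra P.
  split=> [|c x y [? ?] [? ?]|x y [? ?] [? ?]|x [? ?]].
  - by split; exact: salg1.
  - by split; exact: salgP.
  - by split; exact: salgM.
  - by split; exact: salg_star.
have PB : P `<=` B by move=> x [].
have hP : spd P h.
  apply: (spdP tauS (fdalg_subset hB sP PB)) => // z [Nz Bz] z0.
  rewrite -mulrA tauC -mulrA hE; last by apply: salgM => //; exact: salg_star.
  by rewrite mulrA tauC mulrA; apply: (spd_gt0 tauS hB hb (@subset_refl _ B)).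
have hhB := spd_subset PB hP.
have hw : h * w = w * h.
  by have [_ /(_ 0)] := Nh; rewrite oppr0 (pwr0 hb) mulr1 mul1r.
have hbh : h * b = b * h.
  have := congr1 (fun z => z * pwr h (-1)) (hcomm h Nh).
  rewrite -[h * h * _]mulrA -[_ * h * pwr h _]mulrA (mulxV hP) !mulr1 => {1}->.
  by rewrite -mulrA (mulVx hb) mulr1.
have bw : sigma = b * w by rewrite /w mulrA (mulxV hb) mul1r.
have hsig : h * sigma = sigma * h by have := commrM hbh hw; rewrite -bw; exact.
pose k := pwr b (-1) * h.
have kb : pwr b (-1) * h = h * pwr b (-1) by apply: (funcalc_comm hb); rewrite hbh.
have kE : spd BC k.
  apply: (spd_subset B_BC); apply: (spdM tauS) => //.
  exact: spd_inv hb.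
have kN z : N z -> pwr b (-1) * h * (z * b) = z * h.
  move=> Nz; rewrite mulrA -[_ * h * z]mulrA (hcomm _ Nz) !mulrA (mulVx hb) mul1r.
  by rewrite -!mulrA hbh [pwr b (-1) * _]mulrA (mulVx hb) mul1r.
(* Since r = u b with [u] in [N], both sides equal u h. *)
have rk : r * k = k * r.
  have rub : r = u * b by rewrite /u -mulrA (mulVx hb) mulr1.
  by rewrite [in RHS]rub /k (kN _ Nu) mulrA.
have xpos : spd AB (pwr h (-1) * sigma).
  apply: (spdM tauS) => //.
    apply: (spd_subset B_AB); exact: spd_inv hhB.
  by apply: (funcalc_comm hhB).
have ypos : spd BC (r * k) by apply: (spdM tauS).
exists (pwr h (-1) * sigma), (r * k); split.
- exact: spd_positive_in xpos.
- exact: spd_positive_in ypos.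
(* The identity rho = r w gives the factors in the opposite order; adjoints exchange them. *)
- rewrite -[LHS](spd_sa hrho) -[X in X * _](spd_sa xpos) -[X in _ * X](spd_sa ypos) -starM.
  by congr star; rewrite rhoE /k /w -!mulrA [h * _]mulrA (mulxV hhB) mul1r.
Qed.

End Factorization.

                                        

(** * Marginals, densities and entropies *)

Section Marginals.
Variables (R : realType) (T : cstarAlgType R) (tau : T -> R[i]).
Hypothesis tauT : tracial_state tau.
Let tauS := tauT.1.
Let tauC := tauT.2.
Implicit Types (D E : set T) (x y z : T).

Definition marginal E x x0 : Prop := E x0 /\ forall d, E d -> tau (x * d) = tau (x0 * d).

Lemma marginal_spd D E x x0 : fdalg tau D -> fdalg tau E -> E `<=` D -> spd D x ->
  marginal E x x0 -> spd E x0.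
Proof.
move=> hD hE ED hx [Ex0 xx0]; have [hE' _ _] := hE.
apply: (spdP tauS hE Ex0) => [|v Ev v0].
  apply: (trace_ext tauS hE) => // [|d Ed]; first exact: salg_star.
  have sd := salg_star hE' Ed.
  have -> : tau (star x0 * d) = (tau (star d * x0))^* by rewrite -(tau_star tauS) starM starK.
  by rewrite tauC -xx0 // -(tau_star tauS) starM starK (spd_sa hx) [LHS]tauC xx0.
rewrite -mulrA tauC -mulrA -xx0; last by apply: salgM => //; exact: salg_star.
by rewrite mulrA tauC mulrA; exact: (spd_gt0 tauS hD hx ED).
Qed.

Lemma marginal_ex E x : fdalg tau E -> exists x0, marginal E x x0.
Proof. by move=> hE; have [h Eh hx] := riesz tauS x hE; exists h; split=> // d /hx. Qed.

(** With x = star z z, a vector killed by [z] would be killed by rho = y x, against definiteness of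
    [rho]. *)
Lemma positive_factor_spd D E rho x y : fdalg tau D -> fdalg tau E -> E `<=` D ->
  spd D rho -> rho = y * x -> positive_in E x -> spd E x.
Proof.
move=> hD hE ED hrho rhoE [z Ez xE]; have [hE' _ _] := hE.
have xs : star x = x by rewrite xE starM starK.
apply: (spdP tauS hE) => // [|v Ev v0].
  by rewrite xE; apply: salgM => //; exact: salg_star.
rewrite xE mulrA -starM -mulrA; apply: (fdalg_gt0 tauS hE); first exact: salgM.
have := spd_gt0 tauS hD hrho ED Ev v0; rewrite rhoE xE -!mulrA => rho0.
by apply/eqP => zv; move: rho0; rewrite zv !mulr0 (tau0 tauS) ltxx.
Qed.

End Marginals.

Section CommutingSquare.
Variables (R : realType) (T : cstarAlgType R) (tau : T -> R[i]).
Hypothesis tauT : tracial_state tau.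
Let tauS := tauT.1.
Let tauC := tauT.2.
Variables (ABC AB BC B : set T).
Hypothesis hABC : fdalg tau ABC.
Hypothesis hAB : fdalg tau AB.
Hypothesis hBC : fdalg tau BC.
Hypothesis hB : fdalg tau B.
Hypothesis AB_ABC : AB `<=` ABC.
Hypothesis BC_ABC : BC `<=` ABC.
Hypothesis B_AB : B `<=` AB.
Hypothesis B_BC : B `<=` BC.
Hypothesis square_BC : forall y, BC y -> exists2 y0, B y0 &
  forall d, AB d -> tau (y * d) = tau (y0 * d).
Hypothesis square_AB : forall x, AB x -> exists2 x0, B x0 &
  forall d, BC d -> tau (x * d) = tau (x0 * d).
Variables rho sigma r b : T.
Hypothesis hrho : spd ABC rho.
Hypothesis msigma : marginal tau AB rho sigma.
Hypothesis mr : marginal tau BC rho r.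
Hypothesis mb : marginal tau B rho b.
Let sAB : star_subalgebra AB. Proof. by case: hAB. Qed.
Let sBC : star_subalgebra BC. Proof. by case: hBC. Qed.
Let sB : star_subalgebra B. Proof. by case: hB. Qed.

Lemma marginal_square d : BC d -> tau (sigma * d) = tau (b * d).
Proof.
move=> dBC; have [x0 Bx0 x0E] := square_AB msigma.1.
suff -> : b = x0 by exact: x0E.
apply: (trace_ext tauS hB) => // [|z Bz]; first by case: mb.
by rewrite -mb.2 // msigma.2 ?x0E //; [exact: B_BC|exact: B_AB].
Qed.

Lemma product_density_logs x y : positive_in AB x -> positive_in BC y -> rho = x * y ->
  funcalc (@ln R) rho - funcalc (@ln R) sigma - funcalc (@ln R) r + funcalc (@ln R) b = 0.
Proof.
move=> px py rhoE.
have xs : star x = x by case: px => z _ ->; rewrite starM starK.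
have ys : star y = y by case: py => z _ ->; rewrite starM starK.
have xy : x * y = y * x by rewrite -rhoE -{1}(spd_sa hrho) rhoE starM xs ys.
have hx : spd AB x by apply: (positive_factor_spd tauT hABC hAB AB_ABC hrho _ px); rewrite rhoE xy.
have hy : spd BC y by exact: (positive_factor_spd tauT hABC hBC BC_ABC hrho rhoE py).
have ABx := spd_in sAB hx; have BCy := spd_in sBC hy.
have [y0 By0 y0E] := square_BC BCy; have [x0 Bx0 x0E] := square_AB ABx.
have hy0 : spd B y0.
  by apply: (marginal_spd tauT hBC hB B_BC hy); split=> // d /B_AB /y0E.
have hx0 : spd B x0.
  by apply: (marginal_spd tauT hAB hB B_AB hx); split=> // d /B_BC /x0E.
have ABy0 := B_AB By0; have BCx0 := B_BC Bx0.
(* Inside traces against AB the factor [y] may be replaced by [y0] on either side of [x], and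
   likewise [x] by [x0] against BC. This gives both the marginals and their commutation
   relations. *)
have xyAB d : AB d -> tau (x * y * d) = tau (x * y0 * d).
  by move=> dAB; rewrite -!mulrA tauC [RHS]tauC -!mulrA y0E //; exact: salgM.
have yxAB d : AB d -> tau (y * x * d) = tau (y0 * x * d).
  by move=> dAB; rewrite -!mulrA y0E //; exact: salgM.
have xyBC d : BC d -> tau (x * y * d) = tau (x0 * y * d).
  by move=> dBC; rewrite -!mulrA x0E //; exact: salgM.
have yxBC d : BC d -> tau (y * x * d) = tau (y * x0 * d).
  by move=> dBC; rewrite -!mulrA tauC [RHS]tauC -!mulrA x0E //; exact: salgM.
have xy0 : x * y0 = y0 * x.
  apply: (trace_ext tauS hAB) => [||d dAB]; [exact: salgM|exact: salgM|].
  by rewrite -xyAB // xy yxAB.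
have x0y : x0 * y = y * x0.
  apply: (trace_ext tauS hBC) => [||d dBC]; [exact: salgM|exact: salgM|].
  by rewrite -xyBC // xy yxBC.
have x0y0 : x0 * y0 = y0 * x0.
  apply: (trace_ext tauS hB) => [||d dB]; [exact: salgM|exact: salgM|].
  have [dAB dBC] := (B_AB dB, B_BC dB).
  rewrite -mulrA -x0E; last by apply: salgM => //; exact: B_BC.
  rewrite mulrA xy0 -mulrA tauC -mulrA x0E; last by apply: salgM => //; exact: B_BC.
  by rewrite mulrA [LHS]tauC mulrA.
have sigmaE : sigma = x * y0.
  apply: (trace_ext tauS hAB) => [||d dAB]; [by case: msigma|exact: salgM|].
  by rewrite -msigma.2 // rhoE xyAB.
have rE : r = x0 * y.
  apply: (trace_ext tauS hBC) => [||d dBC]; [by case: mr|exact: salgM|].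
  by rewrite -mr.2 // rhoE xyBC.
have bE : b = x0 * y0.
  apply: (trace_ext tauS hB) => [||d dB]; [by case: mb|exact: salgM|].
  rewrite -mb.2 // rhoE (xyAB _ (B_AB dB)) -mulrA x0E ?mulrA //.
  by apply: B_BC; exact: salgM.
rewrite rhoE sigmaE rE bE (funcalc_ln_mul hx hy xy) (funcalc_ln_mul hx hy0 xy0).
rewrite (funcalc_ln_mul hx0 hy x0y) (funcalc_ln_mul hx0 hy0 x0y0).
move: (funcalc _ x) (funcalc _ y) (funcalc _ x0) (funcalc _ y0) => p q s t.
rewrite [p + q]addrC opprD [q + p + _]addrA addrK [s + q]addrC opprD [q - t + _]addrA.
by rewrite [q - t - q]addrAC subrr add0r -opprD [t + s]addrC addNr.
Qed.

End CommutingSquare.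

Section Densities.
Variables (R : realType) (T : cstarAlgType R) (tau : T -> R[i]).
Hypothesis tauT : tracial_state tau.
Let tauS := tauT.1.
Let tauC := tauT.2.
Implicit Types (D E : set T) (phi : T -> R[i]).

Lemma density_unique D phi rho : fdalg tau D -> is_density tau D phi rho ->
  density tau D phi = rho.
Proof.
move=> hD [Drho rhoE]; apply: (@xget_unique _ 0 [set r | is_density tau D phi r]) => //=.
move=> r [Dr rE]; apply: (trace_ext tauS hD) => // d Dd.
by rewrite -rE // rhoE.
Qed.

Lemma density_sa D phi rho : fdalg tau D -> state_on D phi -> is_density tau D phi rho ->
  star rho = rho.
Proof.
move=> hD [_ phi0 _] [Drho rhoE]; have [hD' _ tD] := hD.
pose g := 'i *: (rho - star rho).
have Dg : D g by apply: salgZ => //; apply: salgB => //; exact: salg_star.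
have gs : star g = g by rewrite starZ conjCi raddfB /= starK scaleNr -scalerN opprB.
have gz x : D x -> tau (g * (star x * x)) = 0.
  move=> Dx; have Dxx : D (star x * x) by apply: salgM => //; exact: salg_star.
  rewrite -scalerAl (tauZ tauS) mulrBl (tauB tauS).
  have -> : tau (star rho * (star x * x)) = (tau (rho * (star x * x)))^*.
    by rewrite -(tau_star tauS) !starM starK tauC.
  have : 0 <= tau (rho * (star x * x)) by rewrite -rhoE // phi0.
  by move=> /ger0_real/CrealP ->; rewrite subrr mulr0.
have g0 : g = 0.
  (* Polarization with the vectors 1, [g] and 1 + g leaves twice [tau (g * g)]. *)
  apply: tD => //; have h1 := gz _ (salg1 hD'); have h2 := gz _ Dg.
  have := gz _ (salgD hD' (salg1 hD') Dg).
  rewrite raddfD /= star1 gs !mulrDr !mulrDl !mulrDr !mul1r !mulr1 !(tauD tauS).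
  move: h1 h2; rewrite star1 gs !mulr1 => -> ->; rewrite add0r addr0 -mulr2n => /eqP.
  by rewrite mulrn_eq0 => /eqP.
move/eqP: g0; rewrite scaler_eq0 => /orP[/eqP i0|]; last by rewrite subr_eq0 => /eqP.
by have := neq0Ci R[i]; rewrite i0 eqxx.
Qed.

Lemma density_spd D phi rho : fdalg tau D -> state_on D phi -> faithful_on D phi ->
  is_density tau D phi rho -> spd D rho.
Proof.
move=> hD hphi fphi hrho; have [hD' _ _] := hD; have [Drho rhoE] := hrho.
apply: (spdP tauS hD Drho (density_sa hD hphi hrho)) => v Dv v0.
have Dsv : D (star v) by exact: salg_star.
have -> : tau (star v * rho * v) = phi (star (star v) * star v).
  by rewrite starK rhoE; [rewrite -mulrA tauC mulrA|exact: salgM].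
rewrite lt_def; have [_ -> // _] := hphi; rewrite andbT.
by apply: contra_neq v0 => /(fphi _ Dsv) h; rewrite -[v]starK h raddf0.
Qed.

End Densities.

Theorem theorem5 (R : realType) (CAR : cstarAlgType R) (a : int -> CAR)
    (tau : CAR -> R[i]) (A B C : set int) (phi : CAR -> R[i]) (rho : CAR) :
  car_generators a -> tracial_state tau ->
  finite_set A -> finite_set B -> finite_set C ->
  A `&` B = set0 -> A `&` C = set0 -> B `&` C = set0 ->
  state_on (car_local a (A `|` B `|` C)) phi ->
  faithful_on (car_local a (A `|` B `|` C)) phi ->
  is_density tau (car_local a (A `|` B `|` C)) phi rho ->
  (entropy tau (car_local a (A `|` B `|` C)) phi
   - entropy tau (car_local a (A `|` B)) phi
   - entropy tau (car_local a (B `|` C)) phi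
   + entropy tau (car_local a B) phi = 0
   <->
   exists x y : CAR,
     [/\ positive_in (car_local a (A `|` B)) x,
         positive_in (car_local a (B `|` C)) y &
         rho = x * y]).
Proof.
move=> [aa aas _] tauT /finite_modes[sA uA hA] /finite_modes[sB uB hB] /finite_modes[sC uC hC].
move=> AB0 AC0 BC0 hphi fphi hrho.
have [tauS tauC] := tauT.
(* In the lists below the modes to be traced out come before those of B, as [cliff_expectation] and
   [cliff_flip_fixed] strip a prefix. *)
pose LA := modes sA; pose LB := modes sB; pose LC := modes sC.
have disj (X Y : set int) (s t : seq (int * bool)) : (forall p, p \in s <-> X p.1) ->
    (forall p : int * bool, p \in t <-> Y p.1) -> X `&` Y = set0 ->
    ~~ has (mem s) t.
  move=> hs ht XY; apply/hasPn => p /ht Yp; apply/negP => /hs Xp.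
  by have : (X `&` Y) p.1 by []; rewrite XY.
have uAB : uniq (LA ++ LB) by rewrite cat_uniq !modes_uniq // (disj A B).
have uCB : uniq (LC ++ LB) by rewrite cat_uniq !modes_uniq // (disj C B) // setIC.
have uCAB : uniq (LC ++ (LA ++ LB)).
  rewrite cat_uniq uAB modes_uniq // has_cat negb_or.
  by rewrite (disj C A) // 1?setIC // (disj C B) // setIC.
have uACB : uniq (LA ++ (LC ++ LB)).
  rewrite cat_uniq uCB modes_uniq // has_cat negb_or.
  by rewrite (disj A C) // (disj A B).
pose e := majorana a.
have e_star := majorana_star a : forall i, star (e i) = e i.
have e_sq := majorana_sq aa aas : forall i, e i * e i = 1.
have e_anti := majorana_anti aa aas : forall i j, i != j -> e i * e j = - (e j * e i).
have e_fresh := majorana_fresh.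
have EABC : car_local a (A `|` B `|` C) = cliff e (LC ++ (LA ++ LB)).
  apply: (car_localE aa aas) => // p; rewrite !mem_cat; split.
    by move=> /orP[/hC|/orP[/hA|/hB]] ?; [right|left; left|left; right].
  by move=> [[/hA|/hB]|/hC] ->; rewrite ?orbT.
have EAB : car_local a (A `|` B) = cliff e (LA ++ LB).
  apply: (car_localE aa aas) => // p; rewrite !mem_cat; split.
    by move=> /orP[/hA|/hB] ?; [left|right].
  by move=> [/hA|/hB] ->; rewrite ?orbT.
have EBC : car_local a (B `|` C) = cliff e (LC ++ LB).
  apply: (car_localE aa aas) => // p; rewrite !mem_cat; split.
    by move=> /orP[/hC|/hB] ?; [right|left].
  by move=> [/hB|/hC] ->; rewrite ?orbT.
have EB : car_local a B = cliff e LB by apply: (car_localE aa aas) => //; exact: modes_uniq.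
rewrite EABC EAB EBC EB; rewrite EABC in hphi fphi hrho.
have uLB : uniq LB by exact: modes_uniq.
have fd s (us : uniq s) : fdalg tau (cliff e s) :=
  cliff_fdalg e_star e_sq e_anti e_fresh tauS tauC us.
have mono s t (ut : uniq t) (st : {subset s <= t}) : cliff e s `<=` cliff e t.
  by move=> x; exact: (cliff_mono e_star e_sq e_anti ut st).
have B_AB : cliff e LB `<=` cliff e (LA ++ LB).
  by apply: mono => // p; rewrite mem_cat => ->; rewrite orbT.
have B_BC : cliff e LB `<=` cliff e (LC ++ LB).
  by apply: mono => // p; rewrite mem_cat => ->; rewrite orbT.
have AB_ABC : cliff e (LA ++ LB) `<=` cliff e (LC ++ (LA ++ LB)).
  by apply: mono => // p pin; rewrite mem_cat pin orbT.
have BC_ABC : cliff e (LC ++ LB) `<=` cliff e (LC ++ (LA ++ LB)).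
  by apply: mono => // p; rewrite !mem_cat => /orP[->|->]; rewrite ?orbT.
have square_BC y : cliff e (LC ++ LB) y -> exists2 y0, cliff e LB y0 &
    forall d, cliff e (LA ++ LB) d -> tau (y * d) = tau (y0 * d).
  apply: (cliff_expectation e_star e_sq e_anti e_fresh tauS tauC) => //.
  by move=> p; rewrite mem_cat => ->; rewrite orbT.
have square_AB y : cliff e (LA ++ LB) y -> exists2 y0, cliff e LB y0 &
    forall d, cliff e (LC ++ LB) d -> tau (y * d) = tau (y0 * d).
  apply: (cliff_expectation e_star e_sq e_anti e_fresh tauS tauC) => //.
  by move=> p; rewrite mem_cat => ->; rewrite orbT.
have srho : spd (cliff e (LC ++ (LA ++ LB))) rho := density_spd tauT (fd _ uCAB) hphi fphi hrho.
have [sigma msigma] := marginal_ex tauT rho (fd _ uAB).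
have [r mr] := marginal_ex tauT rho (fd _ uCB).
have [b mb] := marginal_ex tauT rho (fd _ uLB).
have B_ABC : cliff e LB `<=` cliff e (LC ++ (LA ++ LB)) by move=> x /B_AB /AB_ABC.
have ssigma := marginal_spd tauT (fd _ uCAB) (fd _ uAB) AB_ABC srho msigma.
have sr := marginal_spd tauT (fd _ uCAB) (fd _ uCB) BC_ABC srho mr.
have sb := marginal_spd tauT (fd _ uCAB) (fd _ uLB) B_ABC srho mb.
(* The logarithm of a marginal stays in its subalgebra, so all four entropies can be written as
   traces against the single [rho]. *)
have entropyE s x : uniq s -> cliff e s `<=` cliff e (LC ++ (LA ++ LB)) ->
    marginal tau (cliff e s) rho x -> spd (cliff e s) x ->
    entropy tau (cliff e s) phi = - tau (rho * funcalc (@ln R) x).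
  move=> us sub mx sx; rewrite /entropy (density_unique tauT (fd _ us) (rho := x)).
    by rewrite mx.2 //; apply: funcalc_in sx _; case: (fd _ us).
  by split=> [|d dS]; [case: mx|rewrite hrho.2 ?mx.2 //; exact: sub].
have mrho : marginal tau (cliff e (LC ++ (LA ++ LB))) rho rho by split=> //; case: hrho.
rewrite (entropyE _ _ uCAB (@subset_refl _ _) mrho srho) (entropyE _ _ uAB AB_ABC msigma ssigma).
rewrite (entropyE _ _ uCB BC_ABC mr sr) (entropyE _ _ uLB B_ABC mb sb) !opprK.
split=> [eqS|[x [y [px py rhoE]]]]; last first.
  have := product_density_logs tauT (fd _ uCAB) (fd _ uAB) (fd _ uCB) (fd _ uLB)
    AB_ABC BC_ABC B_AB B_BC square_BC square_AB srho msigma mr mb px py rhoE.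
  move=> /(congr1 (fun z => - tau (rho * z))).
  rewrite mulr0 (tau0 tauS) oppr0 mulrDr !mulrBr (tauD tauS) !(tauB tauS).
  by rewrite opprD !opprB => <-; rewrite !addrA; congr (_ - _); ring.
have BlnB : cliff e LB (funcalc (@ln R) b) by apply: funcalc_in sb _; case: (fd _ uLB).
have BCr : cliff e (LC ++ LB) (funcalc (@ln R) r) by apply: funcalc_in sr _; case: (fd _ uCB).
have cocycle := sufficiency tauT (fd _ uCAB) (fd _ uCB) BC_ABC srho
  (spd_subset AB_ABC ssigma) sr (spd_subset B_BC sb) mr.2
  (marginal_square tauT (fd _ uLB) B_AB B_BC square_AB msigma mb).
pose flip f f' := exists i j, [/\ i \in LC, j \notin LC ++ (LA ++ LB) &
  (f = e j * e i /\ f' = e i * e j) \/ (f' = e j * e i /\ f = e i * e j)].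
apply: (factorization tauT (flip := flip) (fd _ uAB) (fd _ uCB) (fd _ uLB) B_AB B_BC
  _ _ _ _ _ srho ssigma sr sb).
- move=> f f' [i [j [_ _ [[-> ->]|[-> ->]]]]]; split; exact: (flip_sq e_sq).
- move=> f f' [i [j [iC jN h]]]; exists i, j; split=> //; case: h; tauto.
- move=> f f' d [i [j [iC jN h]]] dAB.
  have iN : i \notin LA ++ LB.
    by apply/negP => iAB; move: uCAB; rewrite cat_uniq => /and3P[_ /hasPn/(_ _ iAB)/negP].
  have {}jN : j \notin LA ++ LB by move: jN; rewrite mem_cat negb_or => /andP[].
  by case: h => [[-> _]|[_ ->]]; exact: (flip_comm e_anti _ _ dAB).
- move=> f f' d [i [j [iC jN h]]] dBC.
  have sBC := cliff_star_subalgebra e_star e_sq e_anti uCB.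
  have di : cliff e (LC ++ LB) (e i) by apply: cliff_gen; rewrite mem_cat iC.
  have {}jN : j \notin LC ++ LB.
    by apply: contra jN; rewrite !mem_cat => /orP[->|->]; rewrite ?orbT.
  case: h => [[-> ->]|[-> ->]].
    rewrite -[_ * _ * (e i * e j)](_ : e j * (e i * d * e i) * e j = _); last by rewrite !mulrA.
    by apply: (cliff_conj e_sq e_anti jN); do 2?apply: salgM.
  rewrite -[_ * _ * (e j * e i)](_ : e i * (e j * d * e j) * e i = _); last by rewrite !mulrA.
  by do 2?apply: salgM => //; apply: (cliff_conj e_sq e_anti jN).
- move=> d dBC fixd;
  apply: (cliff_flip_fixed e_sq e_anti e_fresh (r := LC ++ (LA ++ LB)) uCB _ _ dBC).
    by move=> p; rewrite !mem_cat => /orP[->|->]; rewrite ?orbT.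
  by move=> i j iC jN; apply: fixd; exists i, j; split=> //; left.
(* On BC the density [r] acts as [rho], which turns the relative entropy condition into the given
   equality of entropies. *)
- apply: cocycle; rewrite -(mr.2 _ BCr) -(mr.2 _ (B_BC _ BlnB)).
  move/eqP: eqS => eqS; apply/eqP; rewrite -subr_eq0 -oppr_eq0 -(eqP eqS).
  by apply/eqP; ring.
Qed.
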